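(* Let $X$ be a Harris ergodic Markov chain on $\mathsf{X}$ with invariant distribution $\pi$ and kernel $P$ satisfying the minorization $P(x,A)\ge s(x)Q(A)$ for all $x\in\mathsf{X}$ and $A\in\mathcal{B}(\mathsf{X})$, where $s:\mathsf{X}\to[0,1]$ satisfies $E_\pi s>0$ and $Q$ is a probability measure. Let $h:\mathsf{X}\to\mathbb{R}$ be measurable, and let $N_t$ and $S_t=\sum_{i=\tau_{t-1}}^{\tau_t-1}h(X_i)$ be the length of, and the sum of $h$ over, the $t$th tour of the associated split chain started with $X_0\sim Q$. If $X$ is polynomially ergodic of order $m>1$ and there exists $\delta>2/(m-1)$ such that $E_\pi|h|^{2+\delta}<\infty$, then $E_QN_t^2<\infty$ and $E_QS_t^2<\infty$.
   Context: $\pi$ is a probability distribution with support $\mathsf{X}\subseteq\mathbb{R}^d$, $d\ge1$; $P^n(x,A)=\Pr(X_{k+n}\in A\mid X_k=x)$, $P=P^1$. Harris ergodic means $\pi$-irreducible, aperiodic and positive Harris recurrent. $X$ is polynomially ergodic of order $m>0$ if there is $M:\mathsf{X}\to\mathbb{R}^+$ with $E_\pi M<\infty$ such that $\|P^n(x,\cdot)-\pi(\cdot)\|\le M(x)n^{-m}$ for all $x\in\mathsf{X}$, $n\in\{1,2,\ldots\}$, where $\|\cdot\|$ is the total variation norm. Residual measure: $\mathsf{R}(x,dy)=\dfrac{P(x,dy)-s(x)Q(dy)}{1-s(x)}$ if $s(x)<1$ and $\mathsf{R}(x,dy)=Q(dy)$ if $s(x)=1$. The split chain $X'=\{(X_0,\delta_0),(X_1,\delta_1),\ldots\}$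 on $\mathsf{X}\times\{0,1\}$ evolves as follows: given $X_i=x$, draw $\delta_i\sim\mathrm{Bernoulli}(s(x))$; if $\delta_i=1$ draw $X_{i+1}\sim Q$, otherwise draw $X_{i+1}\sim\mathsf{R}(x,\cdot)$. $E_Q$ denotes expectation when the split chain is started with $X_0\sim Q$. The regeneration times are $\tau_0=0$ and $\tau_{t+1}=\min\{i>\tau_t:\delta_{i-1}=1\}$, and $N_t=\tau_t-\tau_{t-1}$ for $t\ge1$. (The pairs $(N_t,S_t)$ are i.i.d. The real number $\delta$ in the claim is unrelated to the variables $\delta_i$.) *)

(* Defs.v *)
From HB Require Import structures.
From mathcomp Require Import all_boot all_order all_algebra.
From mathcomp Require Import all_classical all_reals all_analysis.

Set Implicit Arguments.
Unset Strict Implicit.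
Unset Printing Implicit Defensive.

Import Order.TTheory GRing.Theory Num.Theory.
Import numFieldNormedType.Exports.

Local Open Scope classical_set_scope.
Local Open Scope ring_scope.

(* A subset [E] of R^d with its Borel sigma-algebra, i.e. the trace on [E] of
   the product sigma-algebra of [d.-tuple R] (the Borel sigma-algebra of R^d).
   The point [x0] of [E] is only there because measurable types are pointed. *)
Definition state_point {R : realType} {d : nat} {E : set (d.-tuple R)} (x0 : E) :
  Type := set_type E.

Section StateSpace.
Context {R : realType} {d : nat} {E : set (d.-tuple R)} (x0 : E).

HB.instance Definition _ := gen_eqMixin (state_point x0).
HB.instance Definition _ := gen_choiceMixin (state_point x0).
HB.instance Definition _ := isPointed.Build (state_point x0) x0.

Definition state_val (x : state_point x0) : d.-tuple R :=
  set_val (x : set_type E).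

End StateSpace.

Notation state_space x0 := (g_sigma_algebra_preimageType (@state_val _ _ _ x0)).

Section Kernels.
Context {dT : measure_display} {T : measurableType dT} {R : realType}.
Implicit Types (P : R.-pker T ~> T) (pi Q : probability T R) (s : T -> R).

Fixpoint kernel_iter P (n : nat) (x : T) (A : set T) : \bar R :=
  if n is n'.+1 then (\int[P x]_y kernel_iter P n' y A)%E else \d_x A.

Definition tv_norm (mu nu : set T -> \bar R) : \bar R :=
  ereal_sup [set `|mu A - nu A|%E | A in measurable].

Definition invariant_distribution P pi :=
  forall A, measurable A -> (\int[pi]_x P x A)%E = pi A.

Definition irreducible P pi :=
  forall A, measurable A -> (0 < pi A)%E ->
  forall x, exists2 n, (0 < n)%N & (0 < kernel_iter P n x A)%E.

(* There is no cycle D_0 -> D_1 -> ... -> D_(k-1) -> D_0 of length k > 1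
   carrying all the mass of [pi]. *)
Definition aperiodic P pi :=
  forall (k : nat) (D : nat -> set T), (1 < k)%N ->
  (forall i, (i < k)%N -> measurable (D i)) ->
  trivIset `I_k D ->
  (forall i x, (i < k)%N -> D i x -> P x (D (i.+1 %% k)%N) = 1%E) ->
  pi (~` \bigcup_(i in `I_k) D i) <> 0%E.

Definition polynomially_ergodic P pi (m : R) :=
  0 < m /\
  exists M : T -> R,
  [/\ measurable_fun setT M,
      forall x, 0 <= M x,
      ('E_pi[M] < +oo)%E &
      forall x n, (0 < n)%N ->
        (tv_norm (kernel_iter P n x) pi <= (M x * n%:R `^ (- m))%:E)%E].

Definition minorization P s Q :=
  forall x A, measurable A -> ((s x)%:E * Q A <= P x A)%E.

Definition residual P s Q (x : T) (A : set T) : \bar R :=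
  if s x < 1 then ((P x A - (s x)%:E * Q A) * (1 - s x)^-1%:E)%E else Q A.

End Kernels.

(* The sigma-algebra generated by U_0, ..., U_(n-1). *)
Definition history {dO dU : measure_display} {Omega : measurableType dO}
    {TU : measurableType dU} (U : nat -> Omega -> TU) (n : nat) :
    set (set Omega) :=
  <<s \bigcup_(i in `I_n) preimage_set_system setT (U i) measurable >>.

Section Chains.
Context {dT dO : measure_display} {T : measurableType dT}
  {Omega : measurableType dO} {R : realType}.
Implicit Types (P : R.-pker T ~> T) (pi Q : probability T R) (s : T -> R).
Implicit Types (X : nat -> Omega -> T) (b : nat -> Omega -> bool).

(* [Prx x] is the law, on a common sample space, under which the chain [X] with
   kernel [P] starts at [x]. *)
Definition markov_chain P (Prx : T -> probability Omega R) X :=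
  [/\ forall n, measurable_fun setT (X n),
      forall x A, measurable A -> Prx x (X 0%N @^-1` A) = \d_x A &
      forall x n H A, history X n.+1 H -> measurable A ->
        Prx x (H `&` X n.+1 @^-1` A) = (\int[Prx x]_(w in H) P (X n w) A)%E].

Definition harris_recurrent (Prx : T -> probability Omega R) X pi :=
  forall A, measurable A -> (0 < pi A)%E ->
  forall x, Prx x (lim_sup_set (fun n => X n @^-1` A)) = 1%E.

Definition harris_ergodic P (Prx : T -> probability Omega R) X pi :=
  [/\ irreducible P pi, aperiodic P pi, harris_recurrent Prx X pi &
      invariant_distribution P pi].

(* The split chain (X_i, b_i) started with X_0 distributed as [Q]; [b_i] plays
   the role of the regeneration indicator delta_i.  Each variable is drawn
   conditionally on everything that was drawn before it. *)
Definition split_chain P s Q (Pr : probability Omega R) X b :=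
  [/\ (forall n, measurable_fun setT (X n)) /\
      (forall n, measurable_fun setT (b n)),
      forall A, measurable A -> Pr (X 0%N @^-1` A) = Q A,
      forall n H B, <<s history X n.+1 `|` history b n >> H -> measurable B ->
        Pr (H `&` b n @^-1` B) =
        (\int[Pr]_(w in H) bernoulli_prob (s (X n w)) B)%E &
      forall n H A, <<s history X n.+1 `|` history b n.+1 >> H ->
        measurable A ->
        Pr (H `&` X n.+1 @^-1` A) =
        (\int[Pr]_(w in H)
           (if b n w then Q A else residual P s Q (X n w) A))%E].

(* min {i > k : beta_(i-1) = 1}, or [None] if there is no such i. *)
Definition next_regeneration (beta : nat -> bool) (k : nat) : option nat :=
  if pselect (exists i, (k < i)%N && beta i.-1) is left ex
  then Some (ex_minn ex) else None.

Fixpoint regeneration (beta : nat -> bool) (t : nat) : option nat :=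
  if t is t'.+1 then obind (next_regeneration beta) (regeneration beta t')
  else Some 0%N.

(* N_t for t >= 1, equal to +oo when tau_t is not finite. *)
Definition tour_length b (t : nat) (w : Omega) : \bar R :=
  match regeneration (b ^~ w) t.-1, regeneration (b ^~ w) t with
  | Some i, Some j => (j - i)%:R%:E
  | _, _ => +oo%E
  end.

(* S_t for t >= 1.  The value 0 is used only where tau_t is not finite; this
   event is null as soon as N_t has a finite second moment. *)
Definition tour_sum (h : T -> R) X b (t : nat) (w : Omega) : R :=
  match regeneration (b ^~ w) t.-1, regeneration (b ^~ w) t with
  | Some i, Some j => \sum_(i <= k < j) h (X k w)
  | _, _ => 0
  end.

End Chains.

(* Main.v *)
Require Import Defs.
From HB Require Import structures.
From mathcomp Require Import all_boot all_order all_algebra.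
From mathcomp Require Import all_classical all_reals all_analysis.
From mathcomp Require Import measurable_realfun simple_functions.
From mathcomp Require Import measurable_fun_approximation.
From mathcomp Require Import ring lra.

(** The proof rests on the invariance of pi, the minorization, and the bound on
    the total variation distance between P^n and pi.

    Write K(x, A) = P(x, A) - s(x) Q(A) for the taboo kernel, which moves the
    split chain by one step on the event that it does not regenerate.  Started
    from Q, the chain is in A at time n without having regenerated with
    probability Q K^n (A), and every tour is a copy of this excursion.  So, with
    p_n = Q K^n 1 the tail of the tour length, one-time marginals are given by
    the measures Q K^n ([split_chain_taboo]).

    Stationarity bounds these measures.  Since pi P = pi, the identity
    pi K^n f + (E_pi s) * (sum over k < n of Q K^k f) = pi f holds
    ([last_regeneration_decomposition]).  It gives two bounds: the expected sum
    of f >= 0 over a tour is at most (pi f) / (E_pi s), and the tails p_k with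
    k >= n sum to at most a_n / (E_pi s), where a_n = pi K^n 1 is the
    probability that the stationary chain does not regenerate in n steps.

    Mixing bounds a_n.  Leave a gap of length L between two stretches without
    regeneration: K <= P in the gap, and P^L forgets its starting point up to
    M(x) L^(-m), so a_(n+L+k) <= a_n a_k + L^(-m) E_pi M ([survival_mixing]).
    Along n = L = k = 3^j this is a quadratic recursion for a nonincreasing
    sequence that starts at 1 - E_pi s < 1; hence a tends to 0, and then it
    decays like the forcing term: a_(3^j) = O(3^(-mj)) ([quadratic_decay]).
    Therefore the sum of n^g p_n is finite for every g < m
    ([weighted_tour_tail]).

    A second moment would seem to need joint laws at two times.  A weighted
    Cauchy-Schwarz inequality avoids them: with W_n of order n^beta, beta > 1,
    the square of the sum of the x_n is at most a constant times the sum of the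
    W_n x_n^2, and W x^2 <= |x|^(2+delta) + W^((2+delta)/delta).  The first term
    is controlled by E_pi |h|^(2+delta) and the second by the tails p_n, as
    soon as beta (2+delta)/delta < m.  Such a beta > 1 exists exactly when
    delta > 2/(m-1) ([square_sum_bound]).  The case h = 1 is the tour length. *)

Import Order.TTheory GRing.Theory Num.Theory.
Import numFieldNormedType.Exports.

Local Open Scope classical_set_scope.
Local Open Scope ring_scope.

Set Implicit Arguments.
Unset Strict Implicit.
Unset Printing Implicit Defensive.

(** * Decay of a quadratic recursion, and a bound on squared sums *)

Section RealSequences.
Context {R : realType}.

Lemma ltr_powRl (a : R) : 1 < a -> {mono powR a : x y / x < y}.
Proof.
move=> a1 x y; rewrite /powR gt_eqF ?(lt_trans ltr01)//.
by rewrite ltr_expR ltr_pM2r// ln_gt0.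
Qed.

(** The limit l satisfies l <= l^2 and l < 1, so it is 0.  Once b_k <= q/2, the
    quadratic term contracts by q/2, faster than the forcing term C q^k decays,
    so the forcing term dictates the rate. *)
Lemma quadratic_decay (b : nat -> R) (C q : R) : 0 < q < 1 -> 0 <= C ->
  (forall k, 0 <= b k) -> (forall k, b k.+1 <= b k) -> b 0%N < 1 ->
  (forall k, b k.+1 <= b k ^+ 2 + C * q ^+ k) ->
  exists D : R, forall k, b k <= D * q ^+ k.
Proof.
move=> /andP[q0 q1] C0 b0 nb b01 bq.
have nib : nonincreasing_seq b by exact/nonincreasing_seqP.
have cb : cvgn b.
  by apply: nonincreasing_is_cvgn => //; exists 0 => _ [n _ <-].
pose l := limn b.
have l0 : 0 <= l by apply: limr_ge => //; exact: nearW.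
have l1 : l < 1 by apply: le_lt_trans b01; exact: nonincreasing_cvgn_ge.
have qc : C * q ^+ k @[k --> \oo] --> 0.
  rewrite -(mulr0 C); apply: cvgMr; apply: cvg_expr.
  by rewrite ger0_norm ?ltW.
have bb : b k ^+ 2 + C * q ^+ k @[k --> \oo] --> l ^+ 2 + 0.
  apply: cvgD => //; rewrite expr2; under eq_fun do rewrite expr2.
  exact: cvgM.
have ll : l <= l ^+ 2.
  rewrite -[leRHS]addr0 -(cvg_lim _ bb)//; apply: limr_ge.
    by apply/cvg_ex; eexists; exact: bb.
  by apply: nearW => k; apply: le_trans (bq k); exact: nonincreasing_cvgn_ge.
have {}ll : l = 0.
  apply/eqP; rewrite eq_le l0 andbT -(@ler_pM2r _ (1 - l)) ?subr_gt0// mul0r.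
  by rewrite mulrBr mulr1 subr_le0 -expr2.
have [K0 _ bK] : \forall k \near \oo, b k <= q / 2.
  have q20 : 0 < q / 2 by rewrite divr_gt0.
  have := cb; rewrite -/l => /cvgrPdist_le /(_ _ q20).
  apply: filterS => k; rewrite -/l ll sub0r normrN.
  by apply: le_trans; exact: ler_norm.
(* The first term covers the indices up to K0, the second one absorbs C q^k in
   the recursion. *)
pose D := (q ^+ K0)^-1 + 2 * C / q.
have qn k : 0 < q ^+ k by exact: exprn_gt0.
have D0 : 0 <= D.
  apply: addr_ge0; first by rewrite invr_ge0 ltW.
  by apply: divr_ge0; [exact: mulr_ge0|exact: ltW].
have small k : (k <= K0)%N -> b k <= D * q ^+ k.
  move=> kK; apply: (@le_trans _ _ ((q ^+ K0)^-1 * q ^+ K0)).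
    by rewrite mulVf ?gt_eqF// (le_trans _ (ltW b01))//; exact: nib.
  apply: ler_pM; rewrite ?invr_ge0 ?(ltW (qn _))//.
    by rewrite lerDl; apply: divr_ge0; [exact: mulr_ge0|exact: ltW].
  by rewrite ler_wiXn2l// ltW.
exists D; elim=> [|k IH]; first exact: small.
have [kK|Kk] := leqP k.+1 K0; first exact: small.
apply: (le_trans (bq k)).
have h1 : b k ^+ 2 <= q / 2 * (D * q ^+ k).
  by rewrite expr2; apply: ler_pM => //; exact: bK.
have h2 : C * q ^+ k <= q / 2 * (D * q ^+ k).
  rewrite mulrA ler_wpM2r ?(ltW (qn _))//.
  apply: (@le_trans _ _ (q / 2 * (2 * C / q))).
    by rewrite mulrC mulrA divfK ?gt_eqF// mulrC mulKf.
  by rewrite ler_wpM2l ?divr_ge0 ?(ltW q0)// lerDr invr_ge0 ltW.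
apply: (le_trans (lerD h1 h2)); rewrite -mulrDl -splitr exprS.
by rewrite mulrCA.
Qed.

(** The weight is constant on each block [3^j, 3^(j+1)), which reduces the sum
    to a geometric series of ratio k q. *)
Lemma triadic_sum_bounded (p : nat -> R) (D q k : R) : 0 <= k -> 0 <= q ->
  k * q < 1 -> 0 <= D -> (forall n, 0 <= p n) ->
  (forall j, \sum_(3 ^ j <= n < 3 ^ j.+1) p n <= D * q ^+ j) ->
  forall N, \sum_(n < N) k ^+ trunc_log 3 n * p n <= p 0%N + D / (1 - k * q).
Proof.
move=> k0 q0 kq D0 p0 pD N.
have kq0 : 0 <= k * q by exact: mulr_ge0.
have bl J : \sum_(0 <= n < 3 ^ J) k ^+ trunc_log 3 n * p n <=
    p 0%N + D * \sum_(0 <= j < J) (k * q) ^+ j.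
  elim: J => [|J IH].
    by rewrite expn0 big_nat1 big_geq// mulr0 addr0 trunc_log0 expr0 mul1r.
  rewrite (big_cat_nat (n := 3 ^ J))//= ?leq_pexp2l//.
  rewrite [in leRHS]big_nat_recr//= mulrDr addrA lerD//.
  rewrite (eq_big_nat _ _ (F2 := fun n => k ^+ J * p n)); last first.
    by move=> n /(@trunc_log_eq 3 J n isT) ->.
  rewrite -mulr_sumr exprMn mulrCA ler_wpM2l ?exprn_ge0//.
have geo J : \sum_(0 <= j < J) (k * q) ^+ j <= (1 - k * q)^-1.
  rewrite -[leRHS]mul1r ler_pdivlMr ?subr_gt0// mulrC.
  have -> : (1 - k * q) * (\sum_(0 <= j < J) (k * q) ^+ j) = 1 - (k * q) ^+ J.
    by rewrite big_mkord -[RHS]opprB subrX1 -[RHS]mulNr opprB.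
  by rewrite gerBl exprn_ge0.
rewrite -(big_mkord xpredT (fun n => k ^+ trunc_log 3 n * p n)).
apply: (@le_trans _ _ (\sum_(0 <= n < 3 ^ N) k ^+ trunc_log 3 n * p n)).
  rewrite [leRHS](big_cat_nat (n := N))//= ?(ltnW (ltn_expl _ _))//.
  by rewrite lerDl; apply: sumr_ge0 => n _; rewrite mulr_ge0// exprn_ge0.
by apply: (le_trans (bl N)); rewrite lerD2l ler_wpM2l.
Qed.

(** If W <= y^d, the first term dominates; otherwise y < W^(1/d), and the second
    one does. *)
Lemma young_truncation (y W d : R) : 0 <= y -> 0 < W -> 0 < d ->
  W * y ^+ 2 <= y `^ (2 + d) + W `^ ((2 + d) / d).
Proof.
move=> y0 W0 d0; have d2 : 2 + d != 0 by rewrite gt_eqF// addr_gt0.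
have [Wy|yW] := leP W (y `^ d).
  apply: (@le_trans _ _ (y `^ (2 + d))); last by rewrite lerDl powR_ge0.
  rewrite powRD; last by rewrite (negbTE d2).
  by rewrite (powR_mulrn 2)// mulrC ler_wpM2l// sqr_ge0.
apply: (@le_trans _ _ (W `^ ((2 + d) / d))); last by rewrite lerDr powR_ge0.
have -> : (2 + d) / d = 1 + d^-1 * 2.
  by rewrite mulrDl divff ?gt_eqF// addrC mulrC.
have W00 : (W == 0) = false by rewrite gt_eqF.
rewrite powRD ?W00 ?implybT// powRr1 ?(ltW W0)// powRrM powR_mulrn ?powR_ge0//.
rewrite ler_wpM2l ?(ltW W0)// ler_sqr ?nnegrE ?powR_ge0//.
have -> : y = (y `^ d) `^ d^-1 by rewrite -powRrM divff ?gt_eqF// powRr1.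
by apply: ge0_ler_powR; rewrite ?invr_ge0 ?nnegrE ?powR_ge0 ?(ltW _).
Qed.

Lemma weighted_cauchy_schwarz (W x : nat -> R) N : (forall n, 0 < W n) ->
  (\sum_(n < N) x n) ^+ 2 <=
  (\sum_(n < N) (W n)^-1) * (\sum_(n < N) W n * x n ^+ 2).
Proof.
move=> W0; elim: N => [|N IH]; first by rewrite !big_ord0 expr0n mul0r.
rewrite !big_ord_recr/=.
set S := \sum_(n < N) x n in IH *; set A := \sum_(n < N) (W n)^-1 in IH *.
set B := \sum_(n < N) W n * x n ^+ 2 in IH *.
have A0 : 0 <= A by apply: sumr_ge0 => n _; rewrite invr_ge0 ltW.
have B0 : 0 <= B by apply: sumr_ge0 => n _; rewrite mulr_ge0 ?sqr_ge0 ?ltW.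
have w0 := W0 N; set w := W N in w0 *; set y := x N.
have u0 : 0 <= A * (w * y ^+ 2).
  by apply: mulr_ge0 => //; apply: mulr_ge0; [exact: ltW|exact: sqr_ge0].
have v0 : 0 <= w^-1 * B by apply: mulr_ge0 => //; rewrite invr_ge0 ltW.
have uv : (A * (w * y ^+ 2)) * (w^-1 * B) = A * B * y ^+ 2.
  by field; rewrite gt_eqF.
have key : S * y *+ 2 <= A * (w * y ^+ 2) + w^-1 * B.
  apply: le_trans (ler_norm _) _; rewrite -ler_sqr ?nnegrE ?addr_ge0//.
  rewrite real_normK ?num_real// exprMn_n exprMn.
  apply: (@le_trans _ _ ((A * (w * y ^+ 2) * (w^-1 * B)) *+ 4)).
    by rewrite lerMn2r/= uv ler_wpM2r// sqr_ge0.
  move: (A * (w * y ^+ 2)) (w^-1 * B) => u v.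
  rewrite -subr_ge0 -mulr_natr [leRHS](_ : _ = (u - v) ^+ 2) ?sqr_ge0//.
  by ring.
rewrite sqrrD mulrDl !mulrDr mulKf ?gt_eqF//.
rewrite [leRHS](_ : _ = A * B + (A * (w * y ^+ 2) + w^-1 * B) + y ^+ 2).
  by rewrite lerD2r lerD.
by rewrite -!addrA.
Qed.

(** Cauchy-Schwarz with the weights th^j on the block [3^j, 3^(j+1)), followed
    by [young_truncation].  With th = 3^(g d/(2+d)) and kap = 3^g, two things
    are needed: th > 3, so that the inverse weights are summable, and g < m.
    They leave the interval (2+d)/d < g < m, which is not empty exactly because
    d > 2/(m-1). *)
Lemma square_sum_bound (m d : R) : 1 < m -> 2 / (m - 1) < d ->
  exists kap C : R, [/\ 0 <= kap, kap * 3 `^ (- m) < 1, 0 < C &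
    forall (x : nat -> R) N, (\sum_(n < N) x n) ^+ 2 <=
      C * \sum_(n < N) (`|x n| `^ (2 + d) + kap ^+ trunc_log 3 n)].
Proof.
move=> m1 dm; have m10 : 0 < m - 1 by rewrite subr_gt0.
have d0 : 0 < d by apply: le_lt_trans dm; rewrite divr_ge0// ltW.
have d20 : 0 < 2 + d by rewrite addr_gt0.
pose g := ((2 + d) / d + m) / 2.
have gm : (2 + d) / d < m.
  rewrite ltr_pdivrMr// mulrC -subr_gt0.
  by move: dm; rewrite ltr_pdivrMr// -subr_gt0; congr (0 < _); ring.
have [g1 g2] : (2 + d) / d < g /\ g < m by split; rewrite /g; lra.
pose th : R := 3 `^ (g * (d / (2 + d))).
have th3 : 3 < th.
  rewrite /th -[ltLHS]powRr1// ltr_powRl ?ltr1n//.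
  by rewrite mulrA ltr_pdivlMr// mul1r -ltr_pdivrMr.
have th0 : 0 < th by apply: lt_trans th3.
exists (th `^ ((2 + d) / d)), (1 + 3 / (1 - th^-1 * 3)); split.
- exact: powR_ge0.
- rewrite /th -powRrM -mulrA mulf_div [d * _]mulrC divff; last first.
    by rewrite mulf_neq0// gt_eqF.
  rewrite mulr1 -powRD ?pnatr_eq0 ?implybT// -[ltRHS](powRr0 3).
  by rewrite ltr_powRl ?ltr1n// subr_lt0.
- rewrite ltr_pwDl// divr_ge0// subr_ge0 mulrC ler_pdivrMr// mul1r ltW//.
move=> x N; pose W n : R := th ^+ trunc_log 3 n.
have W0 n : 0 < W n by exact: exprn_gt0.
apply: (le_trans (weighted_cauchy_schwarz x N W0)).
apply: ler_pM.
- by apply: sumr_ge0 => n _; rewrite invr_ge0 ltW.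
- by apply: sumr_ge0 => n _; rewrite mulr_ge0 ?sqr_ge0 ?ltW.
- rewrite (eq_bigr (fun n : 'I_N => th^-1 ^+ trunc_log 3 n * 1)); last first.
    by move=> n _; rewrite mulr1 exprVn.
  apply: (@triadic_sum_bounded (fun=> 1) 3 3) => //.
  + by rewrite invr_ge0 ltW.
  + by rewrite mulrC ltr_pdivrMr// mul1r.
  move=> j; rewrite big_const_nat iter_addr addr0 -natrX -natrM -expnS.
  by rewrite ler_nat leq_subr.
have WE n : (th `^ ((2 + d) / d)) ^+ trunc_log 3 n = W n `^ ((2 + d) / d).
  by rewrite /W -!powR_mulrn ?powR_ge0 ?(ltW th0)// powRAC.
apply: ler_sum => n _; rewrite WE -[x n ^+ 2]real_normK ?num_real//.
exact: young_truncation.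
Qed.

End RealSequences.

(** * Integration against composed kernels and densities *)

Import HBNNSimple.

Section FunctionInduction.
Context {dT : measure_display} {T : measurableType dT} {R : realType}.
Local Open Scope ereal_scope.

Definition ge0_measurable (f : T -> \bar R) :=
  (forall x, 0 <= f x) /\ measurable_fun [set: T] f.

Lemma ge0_measurable_indic (A : set T) : measurable A ->
  ge0_measurable (fun x => (\1_A x)%:E).
Proof.
move=> mA; split=> [x|]; first by rewrite lee_fin.
exact/measurable_EFinP/measurable_indic.
Qed.

Lemma ge0_measurableD f g : ge0_measurable f -> ge0_measurable g ->
  ge0_measurable (fun x => f x + g x).
Proof.
move=> [f0 mf] [g0 mg].
by split=> [x|]; [exact: adde_ge0|exact: emeasurable_funD].
Qed.

Lemma ge0_measurableZ (k : \bar R) f : 0 <= k -> ge0_measurable f ->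
  ge0_measurable (fun x => k * f x).
Proof.
by move=> k0 [f0 mf]; split=> [x|]; [exact: mule_ge0|exact: measurable_funeM].
Qed.

Lemma ge0_measurable_cst (k : \bar R) : 0 <= k ->
  ge0_measurable (fun _ : T => k).
Proof. by move=> k0; split=> // x. Qed.

Lemma ge0_measurable_sum (I : Type) (r : seq I) (f : I -> T -> \bar R) :
  (forall i, ge0_measurable (f i)) ->
  ge0_measurable (fun x => \sum_(i <- r) f i x).
Proof.
move=> mf; split=> [x|]; first by apply: sume_ge0 => i _; exact: (mf i).1.
by apply: emeasurable_sum => i; exact: (mf i).2.
Qed.

(** The supremum over the simple functions below f is monotone in f.  In this
    form the comparison applies to tour lengths and tour sums without a
    discussion of their measurability. *)
Lemma le_integral_ge0 (mu : {measure set T -> \bar R}) f g :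
  (forall x, 0 <= f x) -> (forall x, f x <= g x) ->
  \int[mu]_x f x <= \int[mu]_x g x.
Proof.
move=> f0 fg; rewrite !ge0_integralTE//; last first.
  by move=> x; exact: le_trans (fg x).
apply: le_ereal_sup => _ [h hf <-]; exists h => // x.
exact: le_trans (hf x) (fg x).
Qed.

Lemma integral_ge0D (mu : {measure set T -> \bar R}) f g :
  ge0_measurable f -> ge0_measurable g ->
  \int[mu]_x (f x + g x) = \int[mu]_x f x + \int[mu]_x g x.
Proof.
by move=> mf mg; rewrite ge0_integralD//; try exact: mf.2; try exact: mg.2;
  move=> *; [exact: mf.1|exact: mg.1].
Qed.

Lemma integral_ge0Z (mu : {measure set T -> \bar R}) (k : \bar R) f :
  0 <= k -> ge0_measurable f -> \int[mu]_x (k * f x) = k * \int[mu]_x f x.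
Proof.
by move=> k0 mf; rewrite ge0_integralZl//; [exact: mf.2|move=> *; exact: mf.1].
Qed.

Lemma integral_limn (mu : {measure set T -> \bar R}) (F : nat -> T -> \bar R) :
  (forall n, ge0_measurable (F n)) ->
  (forall x, nondecreasing_seq (F ^~ x)) ->
  \int[mu]_x limn (F ^~ x) = limn (fun n => \int[mu]_x F n x).
Proof.
move=> mF nF; rewrite monotone_convergence//.
- by move=> n; exact: (mF n).2.
- by move=> n x _; exact: (mF n).1.
Qed.

(** The standard machine: it transfers identities between integrals from sets
    to nonnegative measurable functions. *)
Lemma ge0_measurable_ind (Pf : (T -> \bar R) -> Prop) :
  (forall A, measurable A -> Pf (fun x => (\1_A x)%:E)) ->
  (forall k f, (0 <= k)%R -> ge0_measurable f -> Pf f ->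
    Pf (fun x => k%:E * f x)) ->
  (forall f g, ge0_measurable f -> ge0_measurable g -> Pf f -> Pf g ->
    Pf (fun x => f x + g x)) ->
  (forall F : nat -> T -> \bar R, (forall n, ge0_measurable (F n)) ->
    (forall x, nondecreasing_seq (F ^~ x)) -> (forall n, Pf (F n)) ->
    Pf (fun x => limn (F ^~ x))) ->
  forall f, ge0_measurable f -> Pf f.
Proof.
move=> Pi PZ PD Plim f [f0 mf].
pose g := nnsfun_approx measurableT mf.
have -> : f = (fun x => limn (fun n => (g n x)%:E)).
  by apply/funext => x; apply/esym/cvg_lim => //; exact: cvg_nnsfun_approx.
have P0 : Pf (fun=> 0).
  have <- : (fun x : T => (\1_set0 x)%:E) = (fun=> 0 : \bar R).
    by apply/funext => x; rewrite indic0.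
  exact: Pi.
have mg (r : R) n : measurable (g n @^-1` [set r]) by exact: measurable_sfunP.
apply: Plim => [n|x|n].
- by split=> [x|]; [rewrite lee_fin|exact/measurable_EFinP].
- by move=> n m nm; rewrite lee_fin; exact/lefP/nd_nnsfun_approx.
(* The maximum does not change the values r of g n; it makes every coefficient
   nonnegative, so that the induction runs over arbitrary lists. *)
pose level (r : R) (x : T) : \bar R :=
  (Num.max 0 r)%:E * (\1_(g n @^-1` [set r]) x)%:E.
have mlevel r : ge0_measurable (level r).
  apply: ge0_measurableZ; first by rewrite lee_fin le_max lexx.
  exact: ge0_measurable_indic.
have -> : (fun x => (g n x)%:E) = (fun x =>
    \sum_(r <- finmap.enum_fset (fset_set (range (g n)))) level r x).
  apply/funext => x; rewrite fimfunE fsbig_finite//= -sumEFin.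
  rewrite !big_seq; apply: eq_bigr => r; rewrite in_fset_set// inE => -[y _ <-].
  by rewrite /level EFinM (max_idPr _).
elim: (finmap.enum_fset _) => [|r rs IH].
  by under eq_fun do rewrite big_nil.
under eq_fun do rewrite big_cons.
apply: PD => //; first exact: ge0_measurable_sum.
apply: PZ; first by rewrite le_max lexx.
  exact: ge0_measurable_indic.
exact: Pi.
Qed.

End FunctionInduction.

Section KernelIntegration.
Context {dT dS : measure_display} {T : measurableType dT}
  {S : measurableType dS} {R : realType}.
Local Open Scope ereal_scope.

Lemma ge0_measurable_kernel (K : R.-ker T ~> S) (f : S -> \bar R) :
  ge0_measurable f -> ge0_measurable (fun x => \int[K x]_y f y).
Proof.
move=> [f0 mf]; split=> [x|]; first exact: integral_ge0.
by apply: measurable_fun_integral_kernel => //; exact: measurable_kernel.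
Qed.

(** The hypothesis says that nu is the composition of mu with K.  Composed
    measures are never constructed: in what follows nu is an invariant
    distribution, or the law of a state of the chain, for which the hypothesis
    is a conditional probability statement. *)
Lemma integral_bind (mu : {measure set T -> \bar R})
    (nu : {measure set S -> \bar R}) (K : R.-ker T ~> S) :
  (forall A, measurable A -> nu A = \int[mu]_x K x A) ->
  forall f, ge0_measurable f ->
  \int[nu]_y f y = \int[mu]_x \int[K x]_y f y.
Proof.
move=> nuE; apply: ge0_measurable_ind.
- move=> A mA; rewrite integral_indic// setIT nuE//.
  by apply: eq_integral => x _; rewrite integral_indic// setIT.
- move=> k f k0 mf IH; have mKf := ge0_measurable_kernel K mf.
  rewrite integral_ge0Z ?lee_fin// IH -integral_ge0Z ?lee_fin//.
  by apply: eq_integral => x _; rewrite integral_ge0Z ?lee_fin.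
- move=> f g mf mg IHf IHg.
  have mKf := ge0_measurable_kernel K mf.
  have mKg := ge0_measurable_kernel K mg.
  rewrite integral_ge0D// IHf IHg -integral_ge0D//.
  by apply: eq_integral => x _; rewrite integral_ge0D.
- move=> F mF nF IH; rewrite integral_limn//.
  under eq_fun do rewrite IH.
  rewrite -integral_limn; first last.
  + move=> x n m nm.
    by apply: le_integral_ge0 => y; [exact: (mF n).1|exact: nF].
  + by move=> n; exact: ge0_measurable_kernel.
  by apply: eq_integral => x _; rewrite integral_limn.
Qed.

End KernelIntegration.

Section DensityIntegration.
Context {dT : measure_display} {T : measurableType dT} {R : realType}.
Local Open Scope ereal_scope.

Lemma ge0_measurableM (f g : T -> \bar R) : ge0_measurable f ->
  ge0_measurable g -> ge0_measurable (fun x => f x * g x).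
Proof.
move=> [f0 mf] [g0 mg].
by split=> [x|]; [exact: mule_ge0|exact: emeasurable_funM].
Qed.

Lemma integral_density (mu nu : {measure set T -> \bar R}) (g : T -> R) :
  ge0_measurable (EFin \o g) ->
  (forall A, measurable A -> nu A = \int[mu]_(x in A) (g x)%:E) ->
  forall f, ge0_measurable f -> \int[nu]_x f x = \int[mu]_x (f x * (g x)%:E).
Proof.
move=> mg nuE; apply: ge0_measurable_ind.
- move=> A mA; rewrite integral_indic// setIT nuE//.
  rewrite integral_mkcond; apply: eq_integral => x _.
  by rewrite epatch_indic muleC.
- move=> k f k0 mf IH; have mfg := ge0_measurableM mf mg.
  rewrite integral_ge0Z ?lee_fin// IH -integral_ge0Z ?lee_fin//.
  by apply: eq_integral => x _; rewrite muleA.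
- move=> f1 f2 mf1 mf2 IH1 IH2.
  have m1 := ge0_measurableM mf1 mg; have m2 := ge0_measurableM mf2 mg.
  rewrite integral_ge0D// IH1 IH2 -integral_ge0D//.
  apply: eq_integral => x _.
  by rewrite ge0_muleDl//; [exact: mf1.1|exact: mf2.1].
- move=> F mF nF IH; rewrite integral_limn//.
  under eq_fun do rewrite IH.
  rewrite -integral_limn; first last.
  + by move=> x n m nm; apply: lee_wpmul2r; [exact: mg.1|exact: nF].
  + by move=> n; exact: ge0_measurableM.
  apply: eq_integral => x _.
  have cF : cvgn (F ^~ x) by apply: ereal_nondecreasing_is_cvgn; exact: nF.
  apply/cvg_lim => //; rewrite muleC; under eq_fun do rewrite muleC.
  exact: cvgeZl.
Qed.

End DensityIntegration.

(** * The taboo kernel and powers of kernels *)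

Section TabooKernel.
Context {dT : measure_display} {T : measurableType dT} {R : realType}.
Variables (P : R.-pker T ~> T) (s : T -> R) (Q : probability T R).
Hypothesis ms : measurable_fun [set: T] s.
Hypothesis minor : minorization P s Q.
Local Open Scope ereal_scope.

(** The maximum changes nothing on measurable sets, by the minorization; it
    ensures that the value is nonnegative on the other sets too. *)
Definition taboo (x : T) (A : set T) : \bar R :=
  maxe 0 (P x A - (s x)%:E * Q A).

Let Pfin x A : measurable A -> P x A \is a fin_num.
Proof. by move=> mA; apply: finite_kernel_measure. Qed.

Let sQfin x A : measurable A -> (s x)%:E * Q A \is a fin_num.
Proof. by move=> mA; rewrite fin_numM// fin_num_measure. Qed.

Lemma tabooE x A : measurable A -> taboo x A = P x A - (s x)%:E * Q A.
Proof.
by move=> mA; apply/max_idPr; rewrite sube_ge0 ?minor ?sQfin// orbT.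
Qed.

Let taboo0 x : taboo x set0 = 0.
Proof. by rewrite tabooE// !measure0 mule0 sube0. Qed.

Let taboo_ge0 x A : 0 <= taboo x A.
Proof. by rewrite le_max lexx. Qed.

Let taboo_sigma_additive x : semi_sigma_additive (taboo x).
Proof.
move=> F mF tF mUF; rewrite tabooE//.
have -> : (fun n => \sum_(0 <= i < n) taboo x (F i)) =
    (fun n => \sum_(0 <= i < n) P x (F i) -
              (s x)%:E * \sum_(0 <= i < n) Q (F i)).
  apply/funext => n; rewrite ge0_sume_distrr; last by [].
  rewrite -sumeN; last by move=> *; apply: fin_num_adde_defl; exact: sQfin.
  by rewrite -big_split/=; apply: eq_bigr => i _; rewrite tabooE.
apply: cvgeB.
- by apply: fin_num_adde_defr; exact: Pfin.
- exact: measure_semi_sigma_additive.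
- by apply: cvgeZl => //; exact: measure_semi_sigma_additive.
Qed.

HB.instance Definition _ x := isMeasure.Build _ _ _ (taboo x)
  (taboo0 x) (taboo_ge0 x) (@taboo_sigma_additive x).

Let taboo_measure : T -> {measure set T -> \bar R} := taboo.

Let measurable_taboo U : measurable U ->
  measurable_fun [set: T] (taboo_measure ^~ U).
Proof.
move=> mU; have -> : taboo_measure ^~ U = (fun x => P x U - (s x)%:E * Q U).
  by apply/funext => x; exact: tabooE.
apply: emeasurable_funB; first exact: measurable_kernel.
apply: emeasurable_funM => //; exact/measurable_EFinP.
Qed.

HB.instance Definition _ := isKernel.Build _ _ _ _ _ taboo_measure
  measurable_taboo.

(** Every later argument uses the decomposition P = K + s Q and no formula for
    K, so that K can be kept abstract. *)
Lemma taboo_kernel : exists K : R.-ker T ~> T,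
  forall x A, measurable A -> K x A + (s x)%:E * Q A = P x A.
Proof.
exists taboo_measure => x A mA.
by rewrite -[taboo_measure x A]/(taboo x A) tabooE// subeK// sQfin.
Qed.

End TabooKernel.

Section KernelPower.
Context {dT : measure_display} {T : measurableType dT} {R : realType}.
Implicit Types (K : R.-ker T ~> T) (f g : T -> \bar R).
Local Open Scope ereal_scope.

Definition kernel_op K f : T -> \bar R := fun x => \int[K x]_y f y.
Definition kernel_pow K n f := iter n (kernel_op K) f.

Lemma ge0_measurable_pow K n f :
  ge0_measurable f -> ge0_measurable (kernel_pow K n f).
Proof. by move=> mf; elim: n => //= n IH; exact: ge0_measurable_kernel. Qed.

Lemma kernel_powD K n k f :
  kernel_pow K (n + k) f = kernel_pow K n (kernel_pow K k f).
Proof. exact: iterD. Qed.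

Lemma le_kernel_op K f g : (forall x, 0 <= f x) ->
  (forall x, f x <= g x) -> forall x, kernel_op K f x <= kernel_op K g x.
Proof. by move=> f0 fg x; exact: le_integral_ge0. Qed.

Lemma kernel_pow_ge0 K n f : (forall x, 0 <= f x) ->
  forall x, 0 <= kernel_pow K n f x.
Proof. by move=> f0; elim: n => //= n IH x; exact: integral_ge0. Qed.

Lemma le_kernel_pow K n f g : (forall x, 0 <= f x) ->
  (forall x, f x <= g x) -> forall x, kernel_pow K n f x <= kernel_pow K n g x.
Proof.
move=> f0 fg; elim: n => //= n IH.
by apply: le_kernel_op => // x; exact: kernel_pow_ge0.
Qed.

Lemma kernel_powD_fun K n f g : ge0_measurable f -> ge0_measurable g ->
  kernel_pow K n (fun x => f x + g x) =
  (fun x => kernel_pow K n f x + kernel_pow K n g x).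
Proof.
move=> mf mg; elim: n => //= n ->; apply/funext => x.
by rewrite [LHS]integral_ge0D//; exact: ge0_measurable_pow.
Qed.

Lemma kernel_powZ K n (k : \bar R) f : 0 <= k -> ge0_measurable f ->
  kernel_pow K n (fun x => k * f x) = (fun x => k * kernel_pow K n f x).
Proof.
move=> k0 mf; elim: n => //= n ->; apply/funext => x.
by rewrite [LHS]integral_ge0Z//; exact: ge0_measurable_pow.
Qed.

Lemma kernel_pow0 K n : kernel_pow K n (fun=> 0) = (fun=> 0).
Proof. by elim: n => //= n ->; apply/funext => x; exact: integral0. Qed.

Lemma kernel_pow_sum K n (I : Type) (r : seq I) (f : I -> T -> \bar R) :
  (forall i, ge0_measurable (f i)) ->
  kernel_pow K n (fun x => \sum_(i <- r) f i x) =
  (fun x => \sum_(i <- r) kernel_pow K n (f i) x).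
Proof.
move=> mf; elim: r => [|i r IH].
  have E h : (fun x => \sum_(i <- [::]) h i x) = (fun=> 0) :> (T -> \bar R).
    by apply/funext => x; rewrite big_nil.
  by rewrite !E kernel_pow0.
have E h : (fun x => \sum_(i <- i :: r) h i x) =
    (fun x => h i x + \sum_(i <- r) h i x) :> (T -> \bar R).
  by apply/funext => x; rewrite big_cons.
rewrite !E kernel_powD_fun ?IH//; exact: ge0_measurable_sum.
Qed.

Lemma kernel_pow_indic (P : R.-pker T ~> T) n (A : set T) x :
  kernel_pow P n (fun x => (\1_A x)%:E) x = kernel_iter P n x A.
Proof.
elim: n x => [x|n IH x] /=; first by rewrite diracE.
by apply: eq_integral => y _; exact: IH.
Qed.

Lemma kernel_pow1 (P : R.-pker T ~> T) n :
  kernel_pow P n (fun=> 1) = (fun=> 1).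
Proof.
elim: n => //= n ->; apply/funext => x.
by rewrite /kernel_op integral_cst// mul1e prob_kernel.
Qed.

(** The sum is the integer part of y. *)
Lemma sum_thresholds (N : nat) (y : R) : (0 <= y <= N%:R)%R ->
  (\sum_(j < N) (j.+1%:R <= y)%R%:R <= y <=
   1 + \sum_(j < N) (j.+1%:R <= y)%R%:R)%R.
Proof.
move=> /andP[y0 yN].
have tN : (Num.trunc y <= N)%N.
  by rewrite -(ler_nat R) (le_trans _ yN)// truncn_le.
have -> : (\sum_(j < N) (j.+1%:R <= y)%R%:R = (Num.trunc y)%:R :> R)%R.
  rewrite -natr_sum; congr (_%:R)%R.
  under eq_bigr do rewrite -truncn_gt_nat.
  rewrite -(big_mkord xpredT (fun j => nat_of_bool (j < Num.trunc y)%N)).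
  rewrite (big_cat_nat (n := Num.trunc y))//=.
  rewrite [X in (_ + X)%N]big1_seq ?addn0; last first.
    move=> j /andP[_]; rewrite mem_index_iota => /andP[+ _].
    by rewrite leqNgt => /negbTE ->.
  rewrite big_nat_cond (eq_bigr (fun=> 1%N)); last first.
    by move=> j /andP[/andP[_ ->]].
  by rewrite -big_nat_cond sum_nat_const_nat subn0 muln1.
rewrite truncn_le y0/= ltW//.
by have /andP[_] := truncn_itv y0; rewrite -natr1 addrC.
Qed.

(** Layer cake: up to 1/N, the function f is the average of the indicators of
    its level sets {f >= j/N}, and to each of them the bound on sets applies. *)
Lemma kernel_pow_tv (P : R.-pker T ~> T) (mu : probability T R) n x (e : R) f :
  (forall A, measurable A -> kernel_iter P n x A <= mu A + e%:E) ->
  ge0_measurable f -> (forall y, f y <= 1) ->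
  kernel_pow P n f x <= \int[mu]_y f y + e%:E.
Proof.
move=> tv mf f1.
have e0 : (0 <= e)%R.
  have := tv _ measurable0; rewrite measure0 add0e -kernel_pow_indic.
  rewrite -[(0 <= e)%R]lee_fin; apply: le_trans.
  by apply: (ge0_measurable_pow P n _).1; exact: ge0_measurable_indic.
apply/lee_addgt0Pr => eps eps0.
pose N := (Num.trunc eps^-1).+1.
have N0 : (0 < N%:R :> R)%R by rewrite ltr0n.
have Neps : (N%:R^-1 <= eps)%R.
  by rewrite -[leRHS]invrK lef_pV2 ?posrE ?invr_gt0// ltW// truncnS_gt.
pose A (j : 'I_N) := [set y | (j.+1%:R / N%:R)%:E <= f y].
have mA j : measurable (A j).
  rewrite -[A j]setTI; apply: emeasurable_fun_c_infty => //; exact: mf.2.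
pose g (j : 'I_N) y : \bar R := (N%:R^-1)%:E * (\1_(A j) y)%:E.
have mg j : ge0_measurable (g j).
  apply: ge0_measurableZ; first by rewrite lee_fin invr_ge0 ltW.
  exact: ge0_measurable_indic.
have fE y : f y = (fine (f y))%:E.
  by rewrite fineK// ge0_fin_numE ?(le_lt_trans (f1 y)) ?ltry//; exact: mf.1.
have sg y : \sum_(j < N) g j y <= f y <= (N%:R^-1)%:E + \sum_(j < N) g j y.
  rewrite fE; have : (0 <= fine (f y) <= 1)%R.
    by rewrite -!lee_fin -fE f1 mf.1.
  move: (fine (f y)) (fE y) => r fr /andP[r0 r1].
  have -> : \sum_(j < N) g j y =
      (N%:R^-1 * \sum_(j < N) (j.+1%:R <= r * N%:R)%R%:R)%:E.
    rewrite mulr_sumr -sumEFin; apply: eq_bigr => j _.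
    rewrite /g -EFinM indicE; congr (_ * _%:R)%:E%R.
    by rewrite (_ : (y \in A j) = (j.+1%:R <= r * N%:R)%R)//; apply/idP/idP;
      rewrite inE /A /= fr lee_fin ler_pdivrMr.
  have rN : (0 <= r * N%:R <= N%:R)%R.
    by rewrite mulr_ge0 ?ler0n//= ler_piMl ?ler0n.
  have /andP[H1 H2] := sum_thresholds rN.
  rewrite -EFinD !lee_fin mulrC ler_pdivrMr// H1/=.
  by rewrite -[X in (X + _)%R]mul1r -mulrDl ler_pdivlMr.
have msg : ge0_measurable (fun y => \sum_(j < N) g j y).
  exact: ge0_measurable_sum.
have m1 : ge0_measurable (fun _ : T => (N%:R^-1 : R)%:E * 1).
  apply: ge0_measurableZ; first by rewrite lee_fin invr_ge0 ltW.
  exact: ge0_measurable_cst.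
apply: (@le_trans _ _ (kernel_pow P n
    (fun y => (N%:R^-1)%:E * 1 + \sum_(j < N) g j y) x)).
  apply: le_kernel_pow => y; first exact: mf.1.
  by rewrite mule1; case/andP: (sg y).
have m2 : ge0_measurable (fun _ : T => 1 : \bar R) by exact: ge0_measurable_cst.
rewrite kernel_powD_fun// kernel_powZ ?lee_fin ?invr_ge0 ?(ltW N0)//.
rewrite kernel_pow1 mule1 kernel_pow_sum// [leLHS]addeC.
apply: leeD; last by rewrite lee_fin.
apply: (@le_trans _ _ (\sum_(j < N) (\int[mu]_y g j y + (e / N%:R)%:E))).
  apply: lee_sum => j _.
  have mi := ge0_measurable_indic (R := R) (mA j).
  rewrite /g kernel_powZ ?lee_fin ?invr_ge0 ?(ltW N0)//.
  rewrite integral_ge0Z ?lee_fin ?invr_ge0 ?(ltW N0)//.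
  rewrite integral_indic// setIT mulrC EFinM -ge0_muleDr// ?lee_fin//.
  by rewrite lee_wpmul2l ?lee_fin ?invr_ge0 ?(ltW N0)// kernel_pow_indic tv.
rewrite big_split/= leeD//.
  rewrite -ge0_integral_sum//; first last.
  - by move=> j y _; exact: (mg j).1.
  - by move=> j; exact: (mg j).2.
  by apply: le_integral_ge0 => y; [exact: msg.1|case/andP: (sg y)].
by rewrite sumEFin sumr_const card_ord lee_fin -[leLHS]mulr_natr divfK// gt_eqF.
Qed.

End KernelPower.

(** * The stationary chain and the tail of a tour *)

Section StationaryTaboo.
Context {dT : measure_display} {T : measurableType dT} {R : realType}.
Variables (P : R.-pker T ~> T) (K : R.-ker T ~> T) (s : T -> R).
Variables (pi Q : probability T R).
Hypothesis ms : measurable_fun [set: T] s.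
Hypothesis s01 : forall x, (0 <= s x <= 1)%R.
Hypothesis KE :
  forall x A, measurable A -> (K x A + (s x)%:E * Q A = P x A)%E.
Hypothesis inv : invariant_distribution P pi.
Local Open Scope ereal_scope.

Let ge0_measurable_s : ge0_measurable (fun x => (s x)%:E).
Proof.
by split=> [x|]; [rewrite lee_fin; case/andP: (s01 x)|exact/measurable_EFinP].
Qed.

Let ge0_intQ f : ge0_measurable f -> 0 <= \int[Q]_y f y.
Proof. by move=> mf; apply: integral_ge0 => x _; exact: mf.1. Qed.

Lemma kernel_op_taboo f x : ge0_measurable f ->
  kernel_op P f x = kernel_op K f x + (s x)%:E * \int[Q]_y f y.
Proof.
move=> mf; have s0 : (0 <= s x)%R by case/andP: (s01 x).
pose sQ := mscale (NngNum s0) Q.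
rewrite /kernel_op (eq_measure_integral (measure_add (K x) sQ)).
  rewrite ge0_integral_measure_add//; [|by move=> y _; exact: mf.1|exact: mf.2].
  by rewrite ge0_integral_mscale//; [exact: mf.2|move=> y _; exact: mf.1].
by move=> A mA _; rewrite [RHS]measure_addE /= -KE.
Qed.

Lemma kernel_op_taboo_le f x : ge0_measurable f ->
  kernel_op K f x <= kernel_op P f x.
Proof.
move=> mf; rewrite kernel_op_taboo// leeDl// mule_ge0 ?ge0_intQ//.
exact: ge0_measurable_s.1.
Qed.

Lemma kernel_pow_taboo_le f n x : ge0_measurable f ->
  kernel_pow K n f x <= kernel_pow P n f x.
Proof.
move=> mf; elim: n x => //= n IH x.
apply: (le_trans (kernel_op_taboo_le _ (ge0_measurable_pow K n mf))).
by apply: le_kernel_op => // y; exact: (ge0_measurable_pow K n mf).1.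
Qed.

Lemma invariant_op f : ge0_measurable f ->
  \int[pi]_x kernel_op P f x = \int[pi]_x f x.
Proof.
by move=> mf; apply/esym/integral_bind => // A mA; rewrite inv.
Qed.

Lemma stationary_pow_le f n : ge0_measurable f ->
  \int[pi]_x kernel_pow K n f x <= \int[pi]_x f x.
Proof.
move=> mf; elim: n => //= n IH; apply: le_trans IH.
have mg := ge0_measurable_pow K n mf.
rewrite -(invariant_op mg); apply: le_integral_ge0 => x.
  exact: (ge0_measurable_kernel K mg).1.
exact: kernel_op_taboo_le.
Qed.

(** The stationary chain, seen at time n, either has not regenerated since time
    0, or, for exactly one k < n, has regenerated at time n - k and then made k
    steps without regeneration.  Formally, pi P = pi makes the sum telescope. *)
Lemma last_regeneration_decomposition f n : ge0_measurable f ->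
  \int[pi]_x kernel_pow K n f x +
    'E_pi[s] * \sum_(k < n) \int[Q]_x kernel_pow K k f x = \int[pi]_x f x.
Proof.
move=> mf; elim: n => [|n IH]; first by rewrite big_ord0 mule0 adde0.
have mg := ge0_measurable_pow K n mf.
rewrite -{}IH big_ord_recr/= ge0_muleDr; first last.
- exact: ge0_intQ.
- by apply: sume_ge0 => k _; apply: ge0_intQ; exact: ge0_measurable_pow.
rewrite [_ * _ + _]addeC addeA; congr (_ + _).
rewrite -(invariant_op mg).
under [RHS]eq_integral do rewrite kernel_op_taboo//.
rewrite integral_ge0D; first last.
- under eq_fun do rewrite muleC; apply: ge0_measurableZ => //; exact: ge0_intQ.
- exact: ge0_measurable_kernel.
congr (_ + _); rewrite unlock muleC -integral_ge0Z ?ge0_intQ//.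
by apply: eq_integral => x _; rewrite muleC.
Qed.

(** The expected sum of f over a tour, truncated at n steps, is at most
    (pi f) / (E_pi s). *)
Lemma tour_occupation_le f n : ge0_measurable f ->
  'E_pi[s] * \sum_(k < n) \int[Q]_x kernel_pow K k f x <= \int[pi]_x f x.
Proof.
move=> mf; rewrite -(last_regeneration_decomposition n mf) leeDr//.
by apply: integral_ge0 => x _; apply: (ge0_measurable_pow K n mf).1.
Qed.

Let one : T -> \bar R := fun=> 1.
Let mone : ge0_measurable one. Proof. exact: ge0_measurable_cst. Qed.

Let int1 (mu : probability T R) : \int[mu]_x one x = 1.
Proof. by rewrite integral_cst// mul1e; exact: probability_setT. Qed.

Lemma taboo_pow_le1 n x : kernel_pow K n one x <= 1.
Proof. by have := kernel_pow_taboo_le n x mone; rewrite kernel_pow1. Qed.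

Lemma survival_le1 n : \int[pi]_x kernel_pow K n one x <= 1.
Proof.
apply: (le_trans (stationary_pow_le n mone)).
by rewrite int1.
Qed.

Lemma survival_nonincreasing n :
  \int[pi]_x kernel_pow K n.+1 one x <= \int[pi]_x kernel_pow K n one x.
Proof.
apply: le_integral_ge0 => x; first exact: (ge0_measurable_pow K n.+1 mone).1.
rewrite -addn1 kernel_powD; apply: le_kernel_pow => y.
  exact: (ge0_measurable_pow K 1 mone).1.
exact: taboo_pow_le1.
Qed.

Lemma regeneration_rate_le1 : 'E_pi[s] <= 1.
Proof.
by have := tour_occupation_le 1 mone; rewrite big_ord1/= !int1 mule1.
Qed.

Section Mixing.
Variables (m : R) (M : T -> R).
Hypothesis mM : measurable_fun [set: T] M.
Hypothesis M0 : forall x, (0 <= M x)%R.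
Hypothesis tvM : forall x n, (0 < n)%N ->
  tv_norm (kernel_iter P n x) pi <= (M x * n%:R `^ (- m))%:E.

(** The middle stretch of length L is a gap in which regenerations are no longer
    tracked: K^L <= P^L, and P^L g is within M L^(-m) of the constant pi g when
    0 <= g <= 1. *)
Lemma survival_mixing n L k : (0 < L)%N ->
  \int[pi]_x kernel_pow K (n + (L + k)) one x <=
  \int[pi]_x kernel_pow K n one x * \int[pi]_x kernel_pow K k one x +
  (L%:R `^ (- m))%:E * 'E_pi[M].
Proof.
move=> L0; set c := \int[pi]_x kernel_pow K k one x.
have mk := ge0_measurable_pow K k mone.
have mLk := ge0_measurable_pow K (L + k) mone.
have mM' : ge0_measurable (EFin \o M).
  by split=> [x|]; [rewrite lee_fin|exact/measurable_EFinP].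
have c0 : 0 <= c by apply: integral_ge0 => x _; exact: mk.1.
have r0 : 0 <= (L%:R `^ (- m))%:E by rewrite lee_fin powR_ge0.
have mc := ge0_measurableZ c0 mone; have mr := ge0_measurableZ r0 mM'.
have H x : kernel_pow K (L + k) one x <=
    c * one x + (L%:R `^ (- m))%:E * (M x)%:E.
  rewrite kernel_powD; apply: (le_trans (kernel_pow_taboo_le L x mk)).
  rewrite mule1 -EFinM mulrC.
  apply: kernel_pow_tv => // [A mA|y]; last exact: taboo_pow_le1.
  rewrite -leeBlDl ?fin_num_measure//.
  apply: (le_trans (lee_abs _)); apply: le_trans (tvM x L0).
  by apply: ereal_sup_ubound; exists A.
rewrite kernel_powD; apply: (@le_trans _ _ (\int[pi]_x kernel_pow K n
   (fun x => c * one x + (L%:R `^ (- m))%:E * (M x)%:E) x)).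
  apply: le_integral_ge0 => x; first exact: (ge0_measurable_pow K n mLk).1.
  by apply: le_kernel_pow => // y; exact: mLk.1.
rewrite kernel_powD_fun// !kernel_powZ// integral_ge0D; first last.
- by apply: ge0_measurableZ => //; exact: ge0_measurable_pow.
- by apply: ge0_measurableZ => //; exact: ge0_measurable_pow.
rewrite !integral_ge0Z//; try exact: ge0_measurable_pow.
rewrite [leLHS]addeC [leRHS]addeC; apply: leeD; last by rewrite muleC.
by rewrite lee_wpmul2l// unlock; exact: stationary_pow_le.
Qed.

Hypothesis m0 : (0 < m)%R.
Hypothesis EM : 'E_pi[M] < +oo.
Hypothesis Es : 0 < 'E_pi[s].

(** The occupation bound for f = K^n 1. *)
Lemma tour_tail n N :
  'E_pi[s] * \sum_(n <= i < N) \int[Q]_x kernel_pow K i one x <=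
  \int[pi]_x kernel_pow K n one x.
Proof.
have [nN|Nn] := leqP n N; last first.
  rewrite big_geq ?mule0 1?ltnW//; apply: integral_ge0 => x _.
  exact: (ge0_measurable_pow K n mone).1.
rewrite -{1}[n]add0n big_addn big_mkord.
under eq_bigr do rewrite kernel_powD.
exact: tour_occupation_le (ge0_measurable_pow K n mone).
Qed.

(** With kap = 3^g, the weight kap^(trunc_log 3 n) is of order n^g, so this is a
    moment of order g + 1 of the tour length, for every g < m. *)
Lemma weighted_tour_tail (kap : R) : (0 <= kap)%R -> (kap * 3 `^ (- m) < 1)%R ->
  exists B : R, forall N,
    \sum_(n < N) (kap ^+ trunc_log 3 n)%:E * \int[Q]_x kernel_pow K n one x
      <= B%:E.
Proof.
move=> kap0 kapq.
have a0 n : 0 <= \int[pi]_x kernel_pow K n one x.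
  by apply: integral_ge0 => x _; exact: (ge0_measurable_pow K n mone).1.
have p0 n : 0 <= \int[Q]_x kernel_pow K n one x.
  by apply: ge0_intQ; exact: ge0_measurable_pow.
have p1 n : \int[Q]_x kernel_pow K n one x <= 1.
  apply: (@le_trans _ _ (\int[Q]_x one x)).
    apply: le_integral_ge0 => x; first exact: (ge0_measurable_pow K n mone).1.
    exact: taboo_pow_le1.
  by rewrite int1.
pose a n := fine (\int[pi]_x kernel_pow K n one x).
pose p n := fine (\int[Q]_x kernel_pow K n one x).
have aE n : \int[pi]_x kernel_pow K n one x = (a n)%:E.
  by rewrite fineK// ge0_fin_numE// (le_lt_trans (survival_le1 n))// ltry.
have pE n : \int[Q]_x kernel_pow K n one x = (p n)%:E.
  by rewrite fineK// ge0_fin_numE// (le_lt_trans (p1 n))// ltry.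
have Es1 := regeneration_rate_le1.
pose c := fine 'E_pi[s].
have cE : 'E_pi[s] = c%:E.
  by rewrite fineK// ge0_fin_numE ?(ltW Es)// (le_lt_trans Es1)// ltry.
have c0 : (0 < c)%R by rewrite -lte_fin -cE.
pose C := fine 'E_pi[M].
have CE : 'E_pi[M] = C%:E.
  rewrite fineK// ge0_fin_numE// unlock; apply: integral_ge0 => x _.
  by rewrite lee_fin.
have C0 : (0 <= C)%R.
  by rewrite -lee_fin -CE unlock; apply: integral_ge0 => x _; rewrite lee_fin.
pose q : R := (3 `^ (- m))%R.
have q0 : (0 < q)%R by rewrite powR_gt0.
have q1 : (q < 1)%R.
  by rewrite /q -[ltRHS](powRr0 3) ltr_powRl ?ltr1n// oppr_lt0.
have qk k : ((3 ^ k)%:R `^ (- m) = q ^+ k)%R.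
  by rewrite natrX -powR_mulrn// -powRrM mulrC powRrM powR_mulrn// powR_ge0.
have [D aD] : exists D, forall k, (a (3 ^ k)%N <= D * q ^+ k)%R.
  apply: (@quadratic_decay _ _ C) => //.
  - by rewrite q0.
  - by move=> k; rewrite -lee_fin -aE.
  - move=> k; rewrite expnS mulSn.
    have : forall i, (a (3 ^ k + i)%N <= a (3 ^ k)%N)%R.
      elim=> [|i]; first by rewrite addn0.
      by apply: le_trans; rewrite addnS -lee_fin -!aE survival_nonincreasing.
    exact.
  - rewrite expn0; have := last_regeneration_decomposition 1 mone.
    rewrite big_ord1 !int1 mule1.
    rewrite [X in X + _](aE 1%N) cE -EFinD => -[<-].
    by rewrite ltrDl.
  - move=> k; have L0 : (0 < 3 ^ k)%N by rewrite expn_gt0.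
    have := survival_mixing (3 ^ k) (3 ^ k) L0.
    rewrite expnS mulSn mulSn mulSn mul0n addn0 !aE CE qk -!EFinM -EFinD.
    by rewrite lee_fin mulrC expr2 (mulrC C).
have D0 : (0 <= D)%R.
  by have := aD 0%N; rewrite expr0 mulr1; apply: le_trans; rewrite -lee_fin -aE.
exists (p 0%N + (D / c) / (1 - kap * q))%R => N.
under eq_bigr do rewrite pE -EFinM.
rewrite sumEFin lee_fin; apply: triadic_sum_bounded => //.
- exact: ltW.
- by rewrite divr_ge0// ltW.
- by move=> n; rewrite -lee_fin -pE.
move=> j; rewrite mulrAC ler_pdivlMr// mulrC.
apply: le_trans (aD j); rewrite -lee_fin -aE.
apply: le_trans (tour_tail (3 ^ j) (3 ^ j.+1)).
rewrite cE (eq_bigr (fun i => (p i)%:E)); last by move=> i _; exact: pE.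
by rewrite sumEFin -EFinM.
Qed.

End Mixing.
End StationaryTaboo.

(** * The split chain between two regenerations *)

Section RestrictedLaw.
Context {dO dT : measure_display} {Om : measurableType dO}
  {T : measurableType dT} {R : realType}.
Variables (mu : {measure set Om -> \bar R}) (D : set Om) (f : Om -> T).
Hypotheses (mD : measurable D) (mf : measurable_fun [set: Om] f).
Local Open Scope ereal_scope.

Let mfA A : measurable A -> measurable (f @^-1` A).
Proof. by move=> mA; rewrite -[X in measurable X]setTI; exact: mf. Qed.

Lemma integral_mrestr (g : Om -> \bar R) : ge0_measurable g ->
  \int[mrestr mu mD]_w g w = \int[mu]_(w in D) g w.
Proof.
move=> mg; rewrite (@integral_density _ _ _ mu _ (\1_D))//.
- rewrite [RHS]integral_mkcond.
  by apply: eq_integral => w _; rewrite epatch_indic.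
- exact: ge0_measurable_indic.
- by move=> A mA; rewrite integral_indic// setIC.
Qed.

Definition restricted_law (A : set T) := mu (D `&` f @^-1` A).

Let restricted_law0 : restricted_law set0 = 0.
Proof. by rewrite /restricted_law preimage_set0 setI0 measure0. Qed.

Let restricted_law_ge0 A : 0 <= restricted_law A.
Proof. exact: measure_ge0. Qed.

Let restricted_law_sigma_additive : semi_sigma_additive restricted_law.
Proof.
move=> F mF tF mUF; rewrite /restricted_law preimage_bigcup setI_bigcupr.
apply: measure_semi_sigma_additive.
- by move=> n; apply: measurableI => //; exact: mfA.
- apply/trivIsetP => /= i j _ _ ij; rewrite setIACA -preimage_setI.
  move/trivIsetP : tF => /(_ _ _ Logic.I Logic.I ij) ->.
  by rewrite preimage_set0 setI0.
- rewrite -setI_bigcupr -preimage_bigcup.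
  by apply: measurableI => //; exact: mfA.
Qed.

HB.instance Definition _ := isMeasure.Build _ _ _ restricted_law
  restricted_law0 restricted_law_ge0 restricted_law_sigma_additive.

(** The law of f on the event D, as a measure on the target space. *)
Lemma restricted_law_exists : exists nu : {measure set T -> \bar R},
  (forall A, nu A = mu (D `&` f @^-1` A)) /\
  (forall g, ge0_measurable g -> \int[nu]_x g x = \int[mu]_(w in D) g (f w)).
Proof.
exists restricted_law; split=> // g mg.
transitivity (\int[pushforward (mrestr mu mD) f]_x g x).
  congr (integral _ _ _); apply/funext => A.
  by rewrite /pushforward /mrestr /= setIC.
rewrite ge0_integral_pushforward//; [|exact: mg.2|by move=> x _; exact: mg.1].
rewrite preimage_setT integral_mrestr//; split=> [w|]; first exact: mg.1.
by apply: measurableT_comp => //; exact: mg.2.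
Qed.

End RestrictedLaw.

Section SplitChain.
Context {dT dO : measure_display} {T : measurableType dT}
  {Om : measurableType dO} {R : realType}.
Variables (P : R.-pker T ~> T) (K : R.-ker T ~> T) (s : T -> R).
Variables (Q : probability T R) (Pr : probability Om R).
Variables (X : nat -> Om -> T) (b : nat -> Om -> bool).
Hypothesis ms : measurable_fun [set: T] s.
Hypothesis s01 : forall x, (0 <= s x <= 1)%R.
Hypothesis KE :
  forall x A, measurable A -> (K x A + (s x)%:E * Q A = P x A)%E.
Hypothesis split : split_chain P s Q Pr X b.
Local Open Scope ereal_scope.

Let mX n : measurable_fun [set: Om] (X n). Proof. by case: split => -[]. Qed.
Let mb n : measurable_fun [set: Om] (b n). Proof. by case: split => -[]. Qed.

(** The information available before the coin is tossed at time n, and after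
    it. *)
Definition past n : set_system Om := <<s history X n.+1 `|` history b n >>.
Definition past_coin n : set_system Om :=
  <<s history X n.+1 `|` history b n.+1 >>.

Lemma history_le (d : measure_display) (U : measurableType d)
    (Y : nat -> Om -> U) n k : (n <= k)%N -> history Y n `<=` history Y k.
Proof.
move=> nk; apply: sub_sigma_algebra2 => A [i /= ik YA]; exists i => //=.
exact: leq_trans nk.
Qed.

Lemma history_measurable (d : measure_display) (U : measurableType d)
    (Y : nat -> Om -> U) n : (forall i, measurable_fun [set: Om] (Y i)) ->
  history Y n `<=` measurable.
Proof.
move=> mY; apply: smallest_sub; first exact: sigma_algebra_measurable.
by move=> A [i _ [B mB <-]]; exact: mY.
Qed.

Lemma history_preimage (d : measure_display) (U : measurableType d)
    (Y : nat -> Om -> U) n i A : (i < n)%N -> measurable A ->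
  history Y n (Y i @^-1` A).
Proof.
move=> ni mA; apply: sub_sigma_algebra; exists i => //=.
by exists A => //; rewrite setTI.
Qed.

Lemma past_coin_measurable n : past_coin n `<=` measurable.
Proof.
apply: smallest_sub; first exact: sigma_algebra_measurable.
by move=> A [|]; apply: history_measurable.
Qed.

Lemma past_sub_coin n : past n `<=` past_coin n.
Proof.
by apply: sub_sigma_algebra2; apply: setUS; exact: history_le.
Qed.

Lemma past_coin_sub n : past_coin n `<=` past n.+1.
Proof.
by apply: sub_sigma_algebra2; apply: setSU; exact: history_le.
Qed.

Lemma g_sigma_algebraI (G : set_system Om) A B :
  <<s G >> A -> <<s G >> B -> <<s G >> (A `&` B).
Proof. exact: (@measurableI _ (g_sigma_algebraType G)). Qed.

Lemma bernoulli_false (p : R) : (0 <= p <= 1)%R ->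
  bernoulli_prob p [set false] = (1 - p)%:E.
Proof. by move=> p01; rewrite /bernoulli_prob p01 fsbig_set1. Qed.

Lemma measurable_residual A : measurable A ->
  ge0_measurable (fun x => residual P s Q x A).
Proof.
move=> mA; split=> [x|].
  rewrite /residual; case: ifPn => // s1; rewrite mule_ge0//.
    by rewrite -KE// addeK ?fin_numM ?fin_num_measure.
  by rewrite lee_fin invr_ge0 subr_ge0 ltW.
rewrite /residual; apply: measurable_fun_ifT => //=.
  by apply: measurable_fun_ltr.
apply: emeasurable_funM.
  apply: emeasurable_funB; first exact: measurable_kernel.
  by apply: emeasurable_funM => //; exact/measurable_EFinP.
apply/measurable_EFinP.
have -> : (fun x => (1 - s x)^-1)%R = (fun x => (1 - s x) `^ (-1))%R.
  apply/funext => x; rewrite powR_inv1// subr_ge0.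
  by case/andP: (s01 x).
apply: (measurableT_comp (measurable_powR (R := R) (-1))).
exact: measurable_funB.
Qed.

(** When s x = 1, the residual measure is Q by convention, but then K x = 0. *)
Lemma residual_taboo x A : measurable A ->
  residual P s Q x A * (1 - s x)%:E = K x A.
Proof.
move=> mA; rewrite /residual; case: ifPn => s1.
  rewrite -muleA -EFinM mulVf ?mule1; last by rewrite subr_eq0 eq_sym lt_eqF.
  by rewrite -KE// addeK// fin_numM// fin_num_measure.
have {}s1 : s x = 1%R.
  by apply/eqP; rewrite eq_le [X in _ && X]leNgt s1 andbT; case/andP: (s01 x).
rewrite s1 subrr mule0; apply/esym/eqP; rewrite eq_le measure_ge0 andbT.
apply: (@le_trans _ _ (K x [set: T])); first by apply: le_measure; rewrite ?inE.
have := KE x measurableT; rewrite s1 mul1e.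
rewrite [Q _](probability_setT Q) [P x _](prob_kernel x).
move=> /(congr1 (fun z => z - 1)); rewrite addeK// => ->.
by rewrite subee.
Qed.

(** Given the past, the coin at time n shows false with probability 1 - s(X_n),
    and the chain then moves by the residual kernel; the product of the two is
    K. *)
Lemma split_chain_step n D (f : T -> \bar R) : past n D -> ge0_measurable f ->
  \int[Pr]_(w in D `&` b n @^-1` [set false]) f (X n.+1 w) =
  \int[Pr]_(w in D) kernel_op K f (X n w).
Proof.
move=> pD mf; have [_ _ coin move_] := split.
set D' := D `&` _.
have pD' : past_coin n D'.
  apply: g_sigma_algebraI; first exact: past_sub_coin.
  by apply: sub_sigma_algebra; right; exact: history_preimage.
have mD' := past_coin_measurable pD'.
have mD := past_coin_measurable (past_sub_coin pD).
(* The laws of X_n on D, of X_n on D', and of X_(n+1) on D'. *)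
have [nu [nuE nuI]] := restricted_law_exists Pr mD (mX n).
have [nu'' [nu''E nu''I]] := restricted_law_exists Pr mD' (mX n).
have [nu' [nu'E nu'I]] := restricted_law_exists Pr mD' (mX n.+1).
rewrite -nu'I// -nuI; last exact: ge0_measurable_kernel.
have ms1 : ge0_measurable (fun x => (1 - s x)%:E).
  split=> [x|]; first by rewrite lee_fin subr_ge0; case/andP: (s01 x).
  by apply/measurable_EFinP; exact: measurable_funB.
apply: integral_bind => // A mA; rewrite nu'E.
transitivity (\int[Pr]_(w in D')
   (if b n w then Q A else residual P s Q (X n w) A)); first exact: move_.
transitivity (\int[Pr]_(w in D') residual P s Q (X n w) A).
  apply: eq_integral => w; rewrite inE => -[_ /= ->]//.
have mr := measurable_residual mA.
rewrite -(nu''I (fun x => residual P s Q x A))//.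
rewrite (@integral_density _ _ _ nu _ (fun x => (1 - s x)%R))//.
  by apply: eq_integral => x _; exact: residual_taboo.
move=> B mB; rewrite nu''E /D' setIAC.
transitivity (\int[Pr]_(w in D `&` X n @^-1` B)
   bernoulli_prob (s (X n w)) [set false]).
  apply: coin => //; apply: g_sigma_algebraI => //.
  by apply: sub_sigma_algebra; left; exact: history_preimage.
transitivity (\int[Pr]_(w in D `&` X n @^-1` B) (1 - s (X n w))%:E).
  by apply: eq_integral => w _; exact: bernoulli_false.
rewrite integral_mkcondr [RHS]integral_mkcond.
transitivity (\int[nu]_x ((1 - s x)%:E * (\1_B x)%:E)); last first.
  by rewrite epatch_indic.
rewrite nuI; last first.
  by apply: ge0_measurableM => //; exact: ge0_measurable_indic.
by apply: eq_integral => w _; rewrite epatch_indic.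
Qed.

(** An event G of the past of time i, on which X_i has law Q, is the start of an
    excursion. *)
Lemma split_chain_taboo i n G (f : T -> \bar R) : past i G ->
  (forall A, measurable A -> Pr (G `&` X i @^-1` A) = Pr G * Q A) ->
  ge0_measurable f ->
  \int[Pr]_(w in G `&` [set w | forall k, (k < n)%N -> ~~ b (i + k) w])
     f (X (i + n) w) =
  Pr G * \int[Q]_x kernel_pow K n f x.
Proof.
move=> pG GQ.
pose D n := G `&` [set w | forall k, (k < n)%N -> ~~ b (i + k) w].
have D0 : D 0%N = G by apply/seteqP; split=> [w []|].
have DS j : D j.+1 = D j `&` b (i + j) @^-1` [set false].
  apply/seteqP; split=> w /=.
    move=> [Gw bw]; split; last by apply/negbTE/bw.
    by split=> // k kj; apply: bw; exact: ltnW.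
  move=> [[Gw bw] bj]; split=> // k.
  by rewrite ltnS leq_eqVlt => /predU1P[->|]; [rewrite bj|exact: bw].
have pD j : past (i + j) (D j).
  elim: j => [|j IH]; first by rewrite addn0 D0.
  rewrite addnS; apply: past_coin_sub; rewrite DS.
  apply: g_sigma_algebraI; first exact: past_sub_coin.
  by apply: sub_sigma_algebra; right; exact: history_preimage.
rewrite -/(D n); elim: n f => [|n IH] f mf.
  rewrite addn0 D0.
  have mG : measurable G.
    by apply: past_coin_measurable; exact: past_sub_coin pG.
  have [nu [nuE nuI]] := restricted_law_exists Pr mG (mX i).
  rewrite -nuI//.
  have PG0 : (0 <= fine (Pr G))%R by rewrite fine_ge0.
  have PGE : (NngNum PG0)%:num%:E = Pr G by rewrite /= fineK// fin_num_measure.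
  rewrite -PGE -ge0_integral_mscale//; first last.
  - by move=> x _; exact: mf.1.
  - exact: mf.2.
  by apply: eq_measure_integral => A mA _; rewrite nuE [LHS]GQ// -[in LHS]PGE.
rewrite /kernel_pow iterSr -/(kernel_pow K n _) -IH; last first.
  exact: ge0_measurable_kernel.
by rewrite addnS DS split_chain_step.
Qed.

End SplitChain.

(** * Regeneration times and sums over a tour *)

Section Regeneration.
Implicit Types beta : nat -> bool.

Lemma next_regenerationP beta k i : next_regeneration beta k = Some i <->
  [/\ (k < i)%N, beta i.-1 & forall l, (k < l < i)%N -> ~~ beta l.-1].
Proof.
rewrite /next_regeneration; case: pselect => [ex|nex]; last first.
  by split=> // -[ki bi _]; exfalso; apply: nex; exists i; rewrite ki.
case: ex_minnP => j /andP[kj bj] jmin; split=> [[<-]|[ki bi il]].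
  split=> // l /andP[kl lj]; apply/negP => bl.
  by have := jmin l; rewrite kl bl leqNgt lj => /(_ isT).
congr Some; apply/eqP; rewrite eqn_leq jmin ?ki//= leqNgt; apply/negP => ji.
by have := il j; rewrite kj ji bj => /(_ isT).
Qed.

Lemma next_regeneration_none beta k : next_regeneration beta k = None ->
  forall i, (k < i)%N -> ~~ beta i.-1.
Proof.
rewrite /next_regeneration; case: pselect => // nex _ i ki.
by apply/negP => bi; apply: nex; exists i; rewrite ki.
Qed.

Lemma regeneration_prefix beta beta' t i :
  (forall k, (k < i)%N -> beta k = beta' k) ->
  regeneration beta t = Some i -> regeneration beta' t = Some i.
Proof.
elim: t i => //= t IH i bb.
case E : (regeneration beta t) => [k|]//= /next_regenerationP[ki bi bl].
rewrite (IH k)//=; last by move=> l lk; apply: bb; exact: ltn_trans ki.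
have il l : (0 < l <= i)%N -> (l.-1 < i)%N by case: l.
apply/next_regenerationP; split=> //.
  by rewrite -bb// il// leqnn (leq_ltn_trans _ ki).
move=> l /andP[kl li]; rewrite -bb ?bl ?kl//.
by rewrite il// (ltnW li) (leq_ltn_trans _ kl).
Qed.

Lemma regeneration_last beta t i : regeneration beta t = Some i.+1 -> beta i.
Proof.
case: t => //= t; case: (regeneration beta t) => [k|]//= /next_regenerationP.
by case.
Qed.

Lemma regenerationS_gt0 beta t i : regeneration beta t.+1 = Some i -> (0 < i)%N.
Proof.
move=> /=; case: (regeneration beta t) => [k|]//= /next_regenerationP[ki _ _].
exact: leq_ltn_trans ki.
Qed.

Lemma tour_open beta t i j n : regeneration beta t = Some i ->
  regeneration beta t.+1 = Some j -> (i + n < j)%N ->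
  forall k, (k < n)%N -> ~~ beta (i + k)%N.
Proof.
move=> /= -> /next_regenerationP[_ _ bl] nj k kn.
have := bl (i + k).+1; apply; rewrite ltnS leq_addr/=.
by rewrite -addnS (leq_ltn_trans _ nj)// leq_add2l.
Qed.

Lemma tour_open_none beta t i : regeneration beta t = Some i ->
  regeneration beta t.+1 = None -> forall k, ~~ beta (i + k)%N.
Proof.
move=> /= -> /next_regeneration_none bl k.
by have := bl (i + k).+1; apply; rewrite ltnS leq_addr.
Qed.

End Regeneration.

Section Tours.
Context {dT dO : measure_display} {T : measurableType dT}
  {Om : measurableType dO} {R : realType}.
Variables (P : R.-pker T ~> T) (K : R.-ker T ~> T) (s : T -> R).
Variables (Q : probability T R) (Pr : probability Om R).
Variables (X : nat -> Om -> T) (b : nat -> Om -> bool).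
Hypothesis ms : measurable_fun [set: T] s.
Hypothesis s01 : forall x, (0 <= s x <= 1)%R.
Hypothesis KE :
  forall x A, measurable A -> (K x A + (s x)%:E * Q A = P x A)%E.
Hypothesis split : split_chain P s Q Pr X b.
Local Open Scope ereal_scope.

(** An event that depends only on the first n coins is a finite union of
    cylinders.  This reduces measurability of events on regeneration times to
    the combinatorics of [regeneration]. *)
Lemma history_of_prefix n (A : set Om) :
  (forall w w', (forall k, (k < n)%N -> b k w = b k w') -> A w -> A w') ->
  history b n A.
Proof.
move=> Aext.
(* The values that the first n coins take on A. *)
pose V := [set v : {ffun 'I_n -> bool} |
  exists2 w, A w & forall k : 'I_n, v k = b k w].
have -> : A = \bigcup_(v in V) \bigcap_(k in [set: 'I_n]) (b k @^-1` [set v k]).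
  apply/seteqP; split=> [w Aw|w' [v [w Aw vw] w'v]].
    exists [ffun k => b (val k) w]; first by exists w => // k; rewrite ffunE.
    by move=> k _ /=; rewrite ffunE.
  apply: Aext Aw => k kn; have := w'v (Ordinal kn) Logic.I.
  by rewrite /= vw.
pose G := \bigcup_(i in `I_n) preimage_set_system setT (b i) measurable.
rewrite -[history b n]/(<<s G >>).
apply: (@fin_bigcup_measurable _ (g_sigma_algebraType G)).
  exact: finite_finset.
move=> v _; apply: (@fin_bigcap_measurable _ (g_sigma_algebraType G)).
  exact: finite_finset.
by move=> k _; exact: (history_preimage (Y := b)).
Qed.

Definition tour_start t i := [set w | regeneration (b^~ w) t = Some i].

(** The tour number t+1 starts at time i and is not finished before time
    i + n + 1. *)
Definition tour_alive t i n := tour_start t i `&`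
  [set w | forall k, (k < n)%N -> ~~ b (i + k) w].

Let past_history i : history b i `<=` past X b i.
Proof. by move=> A bA; apply: sub_sigma_algebra; right. Qed.

Lemma past_tour_start t i : past X b i (tour_start t i).
Proof.
apply: past_history; apply: history_of_prefix => w w' ww'.
exact: regeneration_prefix.
Qed.

Lemma measurable_past i : past X b i `<=` measurable.
Proof.
by move=> A pA; apply: (past_coin_measurable split); exact: past_sub_coin pA.
Qed.

Lemma measurable_tour_start t i : measurable (tour_start t i).
Proof. exact: (measurable_past (@past_tour_start t i)). Qed.

Lemma measurable_tour_alive t i n : measurable (tour_alive t i n).
Proof.
apply: (@measurable_past (i + n)); apply: past_history.
apply: history_of_prefix => w w' ww' [wi wn]; split.
  by apply: regeneration_prefix wi => k ki; apply: ww'; exact: ltn_addr.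
by move=> k kn; rewrite -ww' ?wn// ltn_add2l.
Qed.

(** Apart from time 0, a tour starts right after a coin showing true, whatever
    happened before. *)
Lemma tour_start_law t i A : measurable A ->
  Pr (tour_start t i `&` X i @^-1` A) = Pr (tour_start t i) * Q A.
Proof.
move=> mA; have [_ X0 _ move_] := split.
case: i => [|i].
  case: t => [|t].
    rewrite [tour_start 0 0](_ : _ = setT); last by apply/seteqP; split.
    by rewrite setTI [X in X * _]probability_setT mul1e; exact: X0.
  rewrite [tour_start _ _](_ : _ = set0); last first.
    by apply/seteqP; split=> // w /regenerationS_gt0.
  by rewrite set0I measure0 mul0e.
have pG : past_coin X b i (tour_start t i.+1).
  apply: sub_sigma_algebra; right; apply: history_of_prefix => w w' ww'.
  exact: regeneration_prefix.
transitivity (\int[Pr]_(w in tour_start t i.+1)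
   (if b i w then Q A else residual P s Q (X i w) A)); first exact: move_.
transitivity (\int[Pr]_(w in tour_start t i.+1) Q A).
  by apply: eq_integral => w; rewrite inE => /regeneration_last ->.
have mt := measurable_tour_start t i.+1.
by rewrite integral_cst// muleC.
Qed.

(** The sum of F_n(X_(i+n)) over the tour number t+1, where i is the starting
    time of the tour and n the time elapsed since.  This form also makes sense
    for a tour that never ends. *)
Definition tour_potential (F : nat -> T -> \bar R) t w : \bar R :=
  \sum_(i <oo) \sum_(n <oo) (\1_(tour_alive t i n) w)%:E * F n (X (i + n) w).

Section Potential.
Variable F : nat -> T -> \bar R.
Hypothesis mF : forall n, ge0_measurable (F n).

Lemma ge0_measurable_nneseries (g : nat -> Om -> \bar R) :
  (forall n, ge0_measurable (g n)) ->
  ge0_measurable (fun w => \sum_(n <oo) g n w).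
Proof.
move=> mg; split=> [w|].
  by apply: nneseries_ge0 => n _ _; exact: (mg n).1.
apply: (ge0_emeasurable_sum (P := xpredT)) => [n w _ _|n _].
  exact: (mg n).1.
exact: (mg n).2.
Qed.

Let mX n : measurable_fun [set: Om] (X n). Proof. by case: split => -[]. Qed.

Let mFX n k : ge0_measurable (fun w => F n (X k w)).
Proof.
split=> [w|]; first exact: (mF n).1.
by apply: measurableT_comp => //; exact: (mF n).2.
Qed.

Let mterm t i n : ge0_measurable
  (fun w => (\1_(tour_alive t i n) w)%:E * F n (X (i + n) w)).
Proof.
by apply: ge0_measurableM => //; apply: ge0_measurable_indic;
  exact: measurable_tour_alive.
Qed.

Lemma ge0_measurable_tour_potential t : ge0_measurable (tour_potential F t).
Proof.
by apply: ge0_measurable_nneseries => i; exact: ge0_measurable_nneseries.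
Qed.

Lemma integral_tour_potential_le t (B : R) :
  (forall N, \sum_(n < N) \int[Q]_x kernel_pow K n (F n) x <= B%:E) ->
  \int[Pr]_w tour_potential F t w <= B%:E.
Proof.
move=> FB; have B0 : (0 <= B)%R by have := FB 0%N; rewrite big_ord0 lee_fin.
pose p n := \int[Q]_x kernel_pow K n (F n) x.
have p0 n : 0 <= p n.
  by apply: integral_ge0 => x _; exact: (ge0_measurable_pow K n (mF n)).1.
have FB' : \sum_(n <oo) p n <= B%:E.
  apply: lime_le; first by apply: is_cvg_nneseries => n _ _; exact: p0.
  by apply: nearW => N; rewrite big_mkord; exact: FB.
rewrite integral_nneseries//; first last.
- by move=> i w _; exact: (ge0_measurable_nneseries (mterm t i)).1.
- by move=> i; exact: (ge0_measurable_nneseries (mterm t i)).2.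
have E i : \int[Pr]_w (\sum_(n <oo)
    (\1_(tour_alive t i n) w)%:E * F n (X (i + n) w)) =
    Pr (tour_start t i) * \sum_(n <oo) p n.
  rewrite integral_nneseries//; first last.
  - by move=> n w _; exact: (mterm t i n).1.
  - by move=> n; exact: (mterm t i n).2.
  have PrE : (fine (Pr (tour_start t i)))%:E = Pr (tour_start t i).
    by rewrite fineK// fin_num_measure//; exact: measurable_tour_start.
  rewrite -PrE -nneseriesZl; last by move=> n _; exact: p0.
  apply: eq_eseriesr => n _; rewrite PrE /p -(split_chain_taboo ms s01 KE split
    n (@past_tour_start t i) (@tour_start_law t i) (mF n)).
  rewrite [RHS]integral_mkcond; apply: eq_integral => w _.
  by rewrite epatch_indic muleC.
apply: (@le_trans _ _ (\sum_(i <oo) B%:E * Pr (tour_start t i))).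
  apply: lee_nneseries => i _.
    move=> _; apply: integral_ge0 => w _.
    exact: (ge0_measurable_nneseries (mterm t i)).1.
  by rewrite E muleC lee_wpmul2r.
rewrite nneseriesZl; last by [].
rewrite -[leRHS]mule1 lee_wpmul2l ?lee_fin//.
rewrite -measure_semi_bigcup.
- apply: probability_le1; apply: bigcup_measurable => i _.
  exact: measurable_tour_start.
- by move=> i; exact: measurable_tour_start.
- apply/trivIsetP => i j _ _ /eqP ij; apply/seteqP; split=> // w [wi wj].
  by apply: ij; move: wi wj; rewrite /tour_start /= => -> [].
- by apply: bigcup_measurable => i _; exact: measurable_tour_start.
Qed.

Lemma tour_potential_ge t i N w : (forall n, (n < N)%N -> tour_alive t i n w) ->
  \sum_(n < N) F n (X (i + n) w) <= tour_potential F t w.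
Proof.
move=> wN; pose u j :=
  \sum_(n <oo) (\1_(tour_alive t j n) w)%:E * F n (X (j + n) w).
have u0 j : 0 <= u j by exact: (ge0_measurable_nneseries (mterm t j)).1.
apply: (@le_trans _ _ (u i)).
  apply: le_trans (@nneseries_lim_ge _ _ _ 0%N N _); last first.
    by move=> n _ _; exact: (mterm t i n).1.
  rewrite big_mkord; apply: lee_sum => n _.
  by rewrite indicE mem_set ?mul1e//; exact: wN.
apply: le_trans (@nneseries_lim_ge _ _ _ 0%N i.+1 _); last first.
  by move=> j _ _; exact: u0.
rewrite big_nat_recr//= leeDr//; apply: sume_ge0 => j _; exact: u0.
Qed.

End Potential.

End Tours.

(** * Second moments of tours *)

Section SecondMoments.
Context {dT dO : measure_display} {T : measurableType dT}
  {Om : measurableType dO} {R : realType}.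
Variables (P : R.-pker T ~> T) (K : R.-ker T ~> T) (s : T -> R).
Variables (pi Q : probability T R) (Pr : probability Om R).
Variables (X : nat -> Om -> T) (b : nat -> Om -> bool) (m d : R).
Hypothesis ms : measurable_fun [set: T] s.
Hypothesis s01 : forall x, (0 <= s x <= 1)%R.
Hypothesis Es : (0 < 'E_pi[s])%E.
Hypothesis KE :
  forall x A, measurable A -> (K x A + (s x)%:E * Q A = P x A)%E.
Hypothesis split : split_chain P s Q Pr X b.
Hypothesis inv : invariant_distribution P pi.
Hypothesis poly : polynomially_ergodic P pi m.
Hypothesis m1 : 1 < m.
Hypothesis dm : 2 / (m - 1) < d.
Local Open Scope ereal_scope.

(** The terms of the bound in [square_sum_bound], as functions of the state. *)
Definition moment_weight (h : T -> R) (kap : R) (n : nat) (x : T) : \bar R :=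
  ((`|h x| `^ (2 + d))%:E + (kap ^+ trunc_log 3 n)%:E * 1).

Lemma ge0_measurable_abs_power (h : T -> R) : measurable_fun [set: T] h ->
  ge0_measurable (fun x => (`|h x| `^ (2 + d))%:E).
Proof.
move=> mh; split=> [x|]; first by rewrite lee_fin powR_ge0.
apply/measurable_EFinP.
apply: (measurableT_comp (measurable_powR (R := R) (2 + d))).
exact: measurableT_comp.
Qed.

Lemma ge0_measurable_moment_weight (h : T -> R) kap n :
  measurable_fun [set: T] h -> (0 <= kap)%R ->
  ge0_measurable (moment_weight h kap n).
Proof.
move=> mh kap0; apply: ge0_measurableD; first exact: ge0_measurable_abs_power.
apply: ge0_measurableZ; first by rewrite lee_fin exprn_ge0.
exact: ge0_measurable_cst.
Qed.

Lemma moment_weight_sum_bounded (h : T -> R) kap : measurable_fun [set: T] h ->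
  (0 <= kap)%R -> (kap * 3 `^ (- m) < 1)%R ->
  'E_pi[(fun x => `|h x| `^ (2 + d))%R] < +oo ->
  exists B : R, forall N,
    \sum_(n < N) \int[Q]_x kernel_pow K n (moment_weight h kap n) x <= B%:E.
Proof.
move=> mh kap0 kapm hp.
pose f x := (`|h x| `^ (2 + d))%:E.
have mf : ge0_measurable f := ge0_measurable_abs_power mh.
have [_ [M [mM M0 EM tvM]]] := poly.
have m0 : (0 < m)%R by apply: lt_trans m1.
have [B2 hB2] := weighted_tour_tail ms s01 KE inv mM M0 tvM m0 EM Es kap0 kapm.
have mone : ge0_measurable (fun _ : T => 1 : \bar R).
  exact: ge0_measurable_cst.
have mk n :
    ge0_measurable (fun _ : T => (kap ^+ trunc_log 3 n)%:E * 1 : \bar R).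
  by apply: ge0_measurableZ => //; rewrite lee_fin exprn_ge0.
have Ef : \int[pi]_x f x \is a fin_num.
  rewrite ge0_fin_numE; first by move: hp; rewrite unlock.
  by apply: integral_ge0 => x _; exact: mf.1.
have Es1 := regeneration_rate_le1 ms s01 KE inv.
have EsE : 'E_pi[s] = (fine 'E_pi[s])%:E.
  by rewrite fineK// ge0_fin_numE ?(ltW Es)// (le_lt_trans Es1)// ltry.
have es0 : (0 < fine 'E_pi[s])%R by rewrite -lte_fin -EsE.
exists (fine (\int[pi]_x f x) / fine 'E_pi[s] + B2)%R => N.
have -> : \sum_(n < N) \int[Q]_x kernel_pow K n (moment_weight h kap n) x =
    \sum_(n < N) \int[Q]_x kernel_pow K n f x +
    \sum_(n < N) (kap ^+ trunc_log 3 n)%:E *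
      \int[Q]_x kernel_pow K n (fun=> 1) x.
  rewrite -big_split; apply: eq_bigr => n _ /=.
  have kn0 : 0 <= (kap ^+ trunc_log 3 n)%:E by rewrite lee_fin exprn_ge0.
  have m1n := ge0_measurable_pow K n mone.
  rewrite (kernel_powD_fun K n mf (mk n)) kernel_powZ// integral_ge0D.
  - by rewrite integral_ge0Z.
  - exact: ge0_measurable_pow.
  - exact: ge0_measurableZ.
rewrite EFinD; apply: leeD => //.
rewrite EFinM fineK// muleC lee_pdivlMl// -EsE.
exact: (tour_occupation_le ms s01 KE inv N mf).
Qed.

Definition no_tour t := [set w | regeneration (b^~ w) t = None].

Lemma measurable_no_tour t : measurable (no_tour t).
Proof.
rewrite [no_tour t](_ : _ = ~` \bigcup_i (tour_start b t i)).
  apply: measurableC; apply: bigcup_measurable => i _.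
  exact: (measurable_tour_start split).
apply/seteqP; split=> w; rewrite /no_tour /tour_start /=.
  by move=> wN [i _] /=; rewrite wN.
move=> wt; case E : (regeneration _ _) => [i|]//; exfalso; apply: wt.
by exists i.
Qed.

Section Tour.
Variables (h : T -> R) (kap C : R).
Hypothesis mh : measurable_fun [set: T] h.
Hypothesis kap0 : (0 <= kap)%R.
Hypothesis C0 : (0 < C)%R.
Hypothesis square_bound : forall (x : nat -> R) N, ((\sum_(n < N) x n) ^+ 2 <=
  C * \sum_(n < N) (`|x n| `^ (2 + d) + kap ^+ trunc_log 3 n))%R.

Let V t := tour_potential X b (moment_weight h kap) t.

Let mV t : ge0_measurable (V t).
Proof.
apply: (ge0_measurable_tour_potential split) => n.
exact: ge0_measurable_moment_weight.
Qed.

Lemma tour_square_le t w i j : regeneration (b^~ w) t = Some i ->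
  regeneration (b^~ w) t.+1 = Some j ->
  (((\sum_(i <= k < j) h (X k w)) ^+ 2)%:E <= C%:E * V t w)%E.
Proof.
move=> ti tj; rewrite -{1}[i]add0n big_addn big_mkord.
under eq_bigr do rewrite addnC.
apply: (@le_trans _ _ (C * \sum_(n < j - i) (`|h (X (i + n)%N w)| `^ (2 + d) +
  kap ^+ trunc_log 3 n))%:E).
  by rewrite lee_fin; exact: (square_bound (fun n => h (X (i + n)%N w))).
rewrite EFinM lee_wpmul2l ?lee_fin ?(ltW C0)// -sumEFin.
apply: le_trans (tour_potential_ge split (F := moment_weight h kap) _
  (N := (j - i)%N) (t := t) (i := i) _).
- by apply: lee_sum => n _; rewrite /moment_weight mule1 EFinD.
- by move=> n; exact: ge0_measurable_moment_weight.
move=> n nj; split=> // k; apply: (tour_open ti tj).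
by rewrite -ltn_subRL.
Qed.

End Tour.

Let one : T -> R := fun=> 1%R.

(** On an infinite tour the potential of the constant 1 is infinite; as it has
    finite expectation, almost every tour is finite. *)
Lemma tour_infinite_potential kap t w i : (0 <= kap)%R ->
  regeneration (b^~ w) t = Some i -> regeneration (b^~ w) t.+1 = None ->
  tour_potential X b (moment_weight one kap) t w = +oo.
Proof.
move=> kap0 ti tn; apply/eqyP => r r0.
pose N := (Num.trunc r).+1.
apply: (@le_trans _ _ (N%:R)%:E); first by rewrite lee_fin ltW// truncnS_gt.
apply: le_trans (tour_potential_ge split (F := moment_weight one kap) _
  (N := N) (t := t) (i := i) _).
- have -> : (N%:R)%:E = \sum_(n < N) 1%:E :> \bar R.
    by rewrite sumEFin sumr_const card_ord.
  apply: lee_sum => n _; rewrite /moment_weight normr1 powR1 mule1 -EFinD.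
  by rewrite lee_fin lerDl exprn_ge0.
- by move=> n; apply: ge0_measurable_moment_weight => //; exact: measurable_cst.
by move=> n _; split=> // k _; exact: (tour_open_none ti tn).
Qed.

Lemma one_moment : 'E_pi[(fun x => `|one x| `^ (2 + d))%R] < +oo.
Proof.
rewrite unlock /one normr1 powR1 integral_cst// mul1e.
by rewrite (le_lt_trans (probability_le1 pi measurableT))// ltry.
Qed.

(** By induction on t: if the tour number t+1 starts but is infinite, then the
    potential is infinite, which has probability 0. *)
Lemma no_tour_null t : Pr (no_tour t) = 0.
Proof.
have [kap [C [kap0 kapm C0 square_bound]]] := square_sum_bound m1 dm.
have mone : measurable_fun [set: T] one by exact: measurable_cst.
have [B hB] := moment_weight_sum_bounded mone kap0 kapm one_moment.
have mW n := ge0_measurable_moment_weight n mone kap0.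
elim: t => [|t IH].
  by rewrite [no_tour 0](_ : _ = set0) ?measure0//; apply/seteqP; split.
pose A := no_tour t.+1 `\` no_tour t.
have mA : measurable A by apply: measurableD; exact: measurable_no_tour.
have A0 : Pr A = 0.
  apply/eqP; rewrite eq_le measure_ge0 andbT leNgt; apply/negP => PA.
  have := integral_tour_potential_le ms s01 KE split mW t hB.
  apply/negP; rewrite -ltNge.
  rewrite (@lt_le_trans _ _ (\int[Pr]_w (+oo * (\1_A w)%:E)))//.
    rewrite integral_ge0Z//; last exact: ge0_measurable_indic.
    by rewrite integral_indic// setIT gt0_mulye// ltry.
  apply: le_integral_ge0 => w; first by rewrite mule_ge0 ?lee_fin.
  rewrite indicE; case: (boolP (w \in A)); last first.
    move=> _; rewrite mule0.
    exact: (ge0_measurable_tour_potential split mW t).1.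
  rewrite inE => -[wS wt].
  case E : (regeneration (b^~ w) t) => [i|]; last by [].
  by rewrite (tour_infinite_potential kap0 E wS) mule1.
apply/eqP; rewrite eq_le measure_ge0 andbT.
apply: (@le_trans _ _ (Pr (no_tour t `|` A))).
  apply: le_measure; rewrite ?inE.
  - exact: measurable_no_tour.
  - by apply: measurableU => //; exact: measurable_no_tour.
  by move=> w wS; case: (pselect (no_tour t w)) => wt; [left|right].
have -> : 0%E = Pr (no_tour t) + Pr A by rewrite IH A0 adde0.
by apply: measureU2 => //; exact: measurable_no_tour.
Qed.

Lemma tour_length_square_integrable t :
  \int[Pr]_w (tour_length b t.+1 w ^+ 2) < +oo.
Proof.
have [kap [C [kap0 kapm C0 square_bound]]] := square_sum_bound m1 dm.
have mone : measurable_fun [set: T] one by exact: measurable_cst.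
have [B hB] := moment_weight_sum_bounded mone kap0 kapm one_moment.
have mW n := ge0_measurable_moment_weight n mone kap0.
pose V := tour_potential X b (moment_weight one kap) t.
have mV : ge0_measurable V by exact: (ge0_measurable_tour_potential split).
have mI : ge0_measurable (fun w => +oo * (\1_(no_tour t) w)%:E : \bar R).
  apply: ge0_measurableZ => //; apply: ge0_measurable_indic.
  exact: measurable_no_tour.
have mCV : ge0_measurable (fun w => C%:E * V w).
  by apply: ge0_measurableZ => //; rewrite lee_fin ltW.
(* The infinite term covers the null event on which the tour does not start. *)
apply: (@le_lt_trans _ _
    (\int[Pr]_w (C%:E * V w + +oo * (\1_(no_tour t) w)%:E))).
  apply: le_integral_ge0 => w; first by rewrite sqre_ge0.
  rewrite /tour_length/= indicE.
  case E : (regeneration (b^~ w) t) => [i|]; last first.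
    rewrite mem_set// mule1 addey ?leey// gt_eqF// (lt_le_trans ltNy0)//.
    exact: mCV.1.
  rewrite memNset; last by rewrite /no_tour /= E.
  rewrite mule0 adde0 /=.
  case F : (next_regeneration (b^~ w) i) => [j|].
    have F' : regeneration (b^~ w) t.+1 = Some j by rewrite /= E.
    have := tour_square_le mone kap0 C0 square_bound E F'.
    by rewrite /one sumr_const_nat EFin_expe.
  have F' : regeneration (b^~ w) t.+1 = None by rewrite /= E.
  rewrite /V (tour_infinite_potential kap0 E F').
  by rewrite [leRHS]gt0_muley ?lte_fin// leey.
rewrite integral_ge0D// !integral_ge0Z ?lee_fin ?(ltW C0)//; last first.
  by apply: ge0_measurable_indic; exact: measurable_no_tour.
rewrite integral_indic ?setIT//; last exact: measurable_no_tour.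
rewrite [X in +oo * X]no_tour_null mule0 adde0.
apply: (@le_lt_trans _ _ (C%:E * B%:E)); last by rewrite -EFinM ltry.
rewrite lee_wpmul2l ?lee_fin ?(ltW C0)//.
exact: (integral_tour_potential_le ms s01 KE split mW).
Qed.

Lemma tour_sum_square_integrable (h : T -> R) t : measurable_fun [set: T] h ->
  'E_pi[(fun x => `|h x| `^ (2 + d))%R] < +oo ->
  'E_Pr[(fun w => tour_sum h X b t.+1 w ^+ 2)%R] < +oo.
Proof.
move=> mh hp.
have [kap [C [kap0 kapm C0 square_bound]]] := square_sum_bound m1 dm.
have [B hB] := moment_weight_sum_bounded mh kap0 kapm hp.
have mW n := ge0_measurable_moment_weight n mh kap0.
pose V := tour_potential X b (moment_weight h kap) t.
have mV : ge0_measurable V by exact: (ge0_measurable_tour_potential split).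
rewrite unlock; apply: (@le_lt_trans _ _ (\int[Pr]_w (C%:E * V w))).
  apply: le_integral_ge0 => w; first by rewrite lee_fin sqr_ge0.
  rewrite /tour_sum/=.
  have CV0 : 0 <= C%:E * V w.
    by rewrite mule_ge0 ?lee_fin ?(ltW C0)//; exact: mV.1.
  case E : (regeneration (b^~ w) t) => [i|] /=; last by rewrite expr0n.
  case F : (next_regeneration (b^~ w) i) => [j|]; last by rewrite expr0n.
  have F' : regeneration (b^~ w) t.+1 = Some j by rewrite /= E.
  exact: (tour_square_le mh kap0 C0 square_bound E F').
rewrite integral_ge0Z ?lee_fin ?(ltW C0)//.
apply: (@le_lt_trans _ _ (C%:E * B%:E)); last by rewrite -EFinM ltry.
rewrite lee_wpmul2l ?lee_fin ?(ltW C0)//.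
exact: (integral_tour_potential_le ms s01 KE split mW).
Qed.

End SecondMoments.

Unset Implicit Arguments.
Set Strict Implicit.
Set Printing Implicit Defensive.

Theorem theorem5 (R : realType) (d : nat) (hd : (0 < d)%N)
  (E : set (d.-tuple R)) (x0 : E)
  (pi : probability (state_space x0) R)
  (P : R.-pker (state_space x0) ~> (state_space x0))
  (* the Markov chain X with kernel P, under the laws Prx x, and its Harris
     ergodicity *)
  (dO : measure_display) (Omega : measurableType dO)
  (Prx : state_space x0 -> probability Omega R)
  (X : nat -> Omega -> state_space x0)
  (hX : markov_chain P Prx X)
  (hHarris : harris_ergodic P Prx X pi)
  (s : state_space x0 -> R) (hs : measurable_fun setT s)
  (hs01 : forall x, 0 <= s x <= 1)
  (hspos : (0 < 'E_pi[s])%E)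
  (Q : probability (state_space x0) R)
  (hminor : minorization P s Q)
  (h : state_space x0 -> R) (hh : measurable_fun setT h)
  (* the associated split chain (X', delta_i) started with X'_0 ~ Q *)
  (dO' : measure_display) (Omega' : measurableType dO')
  (PrQ : probability Omega' R)
  (X' : nat -> Omega' -> state_space x0) (b : nat -> Omega' -> bool)
  (hsplit : split_chain P s Q PrQ X' b)
  (m : R) (hm : 1 < m) (hpoly : polynomially_ergodic P pi m)
  (hmoment : exists2 delta : R,
     2 / (m - 1) < delta &
     ('E_pi[(fun x => `|h x| `^ (2 + delta))%R] < +oo)%E) :
  forall t : nat, (0 < t)%N ->
    (\int[PrQ]_w (tour_length b t w ^+ 2) < +oo)%E /\
    ('E_PrQ[(fun w => tour_sum h X' b t w ^+ 2)%R] < +oo)%E.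
Proof.
move=> [//|t] _; have [delta dm hp] := hmoment.
have [_ _ _ inv] := hHarris.
have [K KE] := taboo_kernel hs hminor.
split.
- exact: (tour_length_square_integrable
    hs hs01 hspos KE hsplit inv hpoly hm dm).
- exact: (tour_sum_square_integrable
    hs hs01 hspos KE hsplit inv hpoly hm dm _ hh hp).
Qed.
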